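(* Let $\mathcal M$ be a simple oriented matroid of rank $3$ with at least $7$ elements that is almost positively oriented. Then $\mathcal M$ is isomorphic to a positively oriented matroid.
   Context: Oriented matroids are given by signed circuits on a finite ground set $E$; simple means no loops (circuits $(\{e\},\emptyset)$) and no parallel or antiparallel pairs (circuits $(\{e\},\{f\})$ or $(\{e,f\},\emptyset)$). The chirotope $\chi:E^r\to\{+,-,0\}$ of a rank-$r$ oriented matroid is determined up to global sign by the circuits (for a vector configuration, $\chi(i_1,\dots,i_r)$ is the sign of $\det(\mathbf v_{i_1},\dots,\mathbf v_{i_r})$). An oriented matroid is positively oriented if there is a total order $\prec$ on $E$ (and a choice of chirotope) with $\chi(i_1,\dots,i_r)\in\{0,+\}$ whenever $i_1\prec\dots\prec i_r$. A rank-$3$ oriented matroid $\mathcal M$ is almost positively oriented if for every $e\in E$ the deletion $\mathcal M\setminus e$ (circuits of $\mathcal M$ whose support avoids $e$) is isomorphic to a positively oriented matroid. Isomorphism: reorientation (swapping signs of the elements of a fixed subset in every circuit) followed by bijective relabeling. *)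

(* Defs.v *)
From HB Require Import structures.
From mathcomp Require Import all_boot all_order all_algebra.
From mathcomp Require Import fingroup perm.
Set Implicit Arguments. Unset Strict Implicit. Unset Printing Implicit Defensive.
Import GRing.Theory Num.Theory.
Local Open Scope ring_scope.

Section OM.
Variable E : finType.

(* signed set (X^+, X^-) *)
Definition sset := ({set E} * {set E})%type.
Definition supp (X : sset) : {set E} := X.1 :|: X.2.
Definition opp (X : sset) : sset := (X.2, X.1).

Definition is_OM (G : {set E}) (C : {set sset}) : Prop :=
  [/\ (forall X, X \in C -> supp X \subset G /\ [disjoint X.1 & X.2]),
      (set0, set0) \notin C,
      (forall X, X \in C -> opp X \in C),
      (forall X Y, X \in C -> Y \in C -> supp X \subset supp Y ->
           Y = X \/ Y = opp X) &
      (forall X Y e, X \in C -> Y \in C -> X <> opp Y -> e \in X.1 :&: Y.2 ->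
           exists2 Z, Z \in C &
             Z.1 \subset (X.1 :|: Y.1) :\ e /\ Z.2 \subset (X.2 :|: Y.2) :\ e)].

Definition simple_om (C : {set sset}) : Prop :=
  forall e f, [/\ ([set e], set0) \notin C,
                  ([set e], [set f]) \notin C &
                  ([set e; f], set0) \notin C].

Definition indep (C : {set sset}) (I : {set E}) : Prop :=
  forall X, X \in C -> ~~ (supp X \subset I).

Definition om_rank (G : {set E}) (C : {set sset}) (r : nat) : Prop :=
  (exists I : {set E}, [/\ I \subset G, indep C I & #|I| = r]) /\
  (forall I : {set E}, I \subset G -> indep C I -> (#|I| <= r)%N).

Definition is_basis (C : {set sset}) (r : nat) (G B : {set E}) : Prop :=
  [/\ B \subset G, indep C B & #|B| = r].

Definition del_ground (G : {set E}) (e : E) : {set E} := G :\ e.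
Definition del_circ (C : {set sset}) (e : E) : {set sset} :=
  [set X in C | e \notin supp X].

Definition reorient (A : {set E}) (X : sset) : sset :=
  ((X.1 :\: A) :|: (X.2 :&: A), (X.2 :\: A) :|: (X.1 :&: A)).

Definition tperm (r : nat) (t : r.-tuple E) (s : 'S_r) : r.-tuple E :=
  [tuple tnth t (s i) | i < r].

Definition treplace (r : nat) (t : r.-tuple E) (i : nat) (x : E) : r.-tuple E :=
  [tuple if (j == i :> nat) then x else tnth t j | j < r].

(* the fundamental signed circuit of x0 w.r.t. the ordered basis t:
   X(x0) = chi(t), X(t_i) = - chi(t with t_i replaced by x0), 0 elsewhere;
   (equivalently X(x_i) = (-1)^i chi(x0,x1,..,^x_i,..,x_r) with x_0 = x0) *)
Definition fund_val (r : nat) (chi : r.-tuple E -> int) (t : r.-tuple E)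
  (x0 e : E) : int :=
  if e == x0 then chi t
  else if e \in (t : seq E) then - chi (treplace t (index e t) x0) else 0.

Definition fund_circ (G : {set E}) (r : nat) (chi : r.-tuple E -> int)
  (t : r.-tuple E) (x0 : E) : sset :=
  ([set e in G | 0 < fund_val chi t x0 e], [set e in G | fund_val chi t x0 e < 0]).

Definition in_ground (G : {set E}) (r : nat) (t : r.-tuple E) : bool :=
  all (fun x => x \in G) t.

Definition is_chirotope (G : {set E}) (C : {set sset}) (r : nat)
  (chi : r.-tuple E -> int) : Prop :=
  [/\ om_rank G C r,
      (forall t, in_ground G t -> chi t \in [:: -1; 0; 1]),
      (forall t, in_ground G t ->
          (chi t != 0) <-> (uniq t /\ is_basis C r G [set x in (t : seq E)])),
      (forall t (s : 'S_r), in_ground G t ->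
          chi (tperm t s) = (-1) ^+ (odd_perm s) * chi t) &
      (forall t x0, in_ground G t -> chi t != 0 -> x0 \in G ->
          x0 \notin (t : seq E) -> fund_circ G chi t x0 \in C)].

(* positively oriented: a total order on G (given by an injective rank
   function rk) and a chirotope nonnegative on increasing tuples *)
Definition pos_oriented (G : {set E}) (C : {set sset}) : Prop :=
  exists (r : nat) (rk : E -> nat) (chi : r.-tuple E -> int),
    [/\ {in G &, injective rk},
        @is_chirotope G C r chi &
        (forall t, in_ground G t -> sorted (fun a b => (rk a < rk b)%N) t ->
            0 <= chi t)].

End OM.

Definition om_iso (E1 E2 : finType) (G1 : {set E1}) (C1 : {set sset E1})
  (G2 : {set E2}) (C2 : {set sset E2}) : Prop :=
  exists (A : {set E1}) (f : E1 -> E2),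
    [/\ A \subset G1, {in G1 &, injective f}, f @: G1 = G2 &
        C2 = [set (f @: (reorient A X).1, f @: (reorient A X).2) | X in C1]].

Definition iso_to_pos (E : finType) (G : {set E}) (C : {set sset E}) : Prop :=
  exists (T : finType) (G' : {set T}) (C' : {set sset T}),
    [/\ is_OM G' C', pos_oriented G' C' & om_iso G C G' C'].

Definition almost_pos (E : finType) (G : {set E}) (C : {set sset E}) : Prop :=
  forall e, e \in G -> iso_to_pos (del_ground G e) (del_circ C e).

(* Main.v *)
(* The circuits determine a chirotope chi of M, glued from the chirotopes of the deletions,
   and chi satisfies the 3-term Grassmann-Pluecker relations. It remains to find a total order
   and signs eps such that eps x * eps y * eps z * chi x y z >= 0 whenever x < y < z.

   If some line L has at least 4 points, delete b on L and rotate the order of M \ b so that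
   the other points of L come first. Either b can be inserted among them, or b comes after all
   of them on L and some line spanned by two points off L separates b from them; in the
   second case the first point b1 of L can be inserted into the order of M \ b1.

   Otherwise no line has 4 points, and then a nonnegative order of at least 7 points is unique
   up to rotation and reversal: two orders are compared on 7-point subsets, where uniqueness
   is a finite computation. With at least 9 points, the orders of two deletions therefore agree
   on their common part and all of them glue together. For 7 and 8 points, an exhaustive search
   over the chirotopes extending a nonnegative one on all points but the last shows that
   a chirotope all of whose deletions can be ordered can be ordered itself. *)

From mathcomp Require Import all_boot all_order all_algebra.
From mathcomp Require Import fingroup perm zify.
Require Import Defs.
Set Implicit Arguments. Unset Strict Implicit. Unset Printing Implicit Defensive.

(** * Signs and nonnegative orders *)

(** That circuits determine a chirotope is itself a theorem in general. It is bypassed: a deletion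
    isomorphic to a positively oriented matroid brings a chirotope along, which is pulled back. Two
    such chirotopes differ by a constant sign on common bases, because an exchange of one basis
    element compares two values through a single fundamental circuit. Orders of deletions are less
    rigid. Rotation, and reversal with all points reoriented, preserve nonnegativity, so orders are
    normalized by three fixed points before they are compared. Long lines destroy uniqueness
    altogether: if all points but one lie on a line, that point can stand anywhere in the order once
    the points behind it are reoriented. Hence lines with four points are treated apart, and their
    absence prunes the finite search. The bound 9 is 7 + 2, since two deletions share all but two
    points. *)

Inductive sg := Sg0 | SgP | SgN.
Definition sopp s := match s with Sg0 => Sg0 | SgP => SgN | SgN => SgP end.
Definition smul s t := match s with Sg0 => Sg0 | SgP => t | SgN => sopp t end.
Definition sflip (b : bool) s := if b then sopp s else s.
Definition nneg s := if s is SgN then false else true.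
Definition is0 s := if s is Sg0 then true else false.

(* The three terms of a Grassmann-Pluecker relation can cancel. *)
Definition cancel3 p q r :=
  match p, q, r with
  | Sg0, Sg0, Sg0 => true
  | _, _, _ =>
    let isP s := if s is SgP then true else false in
    let isN s := if s is SgN then true else false in
    (if isP p then true else if isP q then true else isP r) &&
    (if isN p then true else if isN q then true else isN r)
  end.

Definition alternating (T : Type) (chi : T -> T -> T -> sg) :=
  (forall x y z, chi y x z = sopp (chi x y z)) /\
  (forall x y z, chi x z y = sopp (chi x y z)).

Definition gp3 (T : Type) (chi : T -> T -> T -> sg) := forall a b c d e,
  cancel3 (smul (chi a b c) (chi a d e)) (sopp (smul (chi a b d) (chi a c e)))
          (smul (chi a b e) (chi a c d)).

Definition rchi (T : Type) (eps : T -> bool) (chi : T -> T -> T -> sg) x y z :=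
  sflip (eps x) (sflip (eps y) (sflip (eps z) (chi x y z))).

Definition posfor (T : Type) (P : pred T) (rk : T -> nat) (chi : T -> T -> T -> sg) :=
  forall x y z, P x -> P y -> P z -> rk x < rk y -> rk y < rk z -> nneg (chi x y z).

(** An order is a rank in [nat], so that it can be rotated by adding a constant to some ranks and
    refined by doubling them all. *)
Definition posord (T : Type) (P : pred T) (chi : T -> T -> T -> sg) :=
  exists (rk : T -> nat) (eps : T -> bool),
    (forall x y, P x -> P y -> rk x = rk y -> x = y) /\ posfor P rk (rchi eps chi).

(** The six permutations of [c], [d], [e] give one instance of the exchange for each of the three
    terms and each of its two signs: a nonzero term always meets one of opposite sign. *)
Lemma gp3_of_exchange (T : Type) (chi : T -> T -> T -> sg) :
  alternating chi ->
  (forall a b c d e, smul (chi a b c) (chi a d e) = SgP ->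
     smul (chi a b d) (chi a c e) = SgP \/ smul (chi a b e) (chi a d c) = SgP) ->
  gp3 chi.
Proof.
move=> [_ A] H a b c d e.
have := H a b c d e; have := H a b c e d; have := H a b d c e.
have := H a b d e c; have := H a b e c d; have := H a b e d c.
rewrite (A a d e) (A a c e) (A a c d).
case: (chi a b c); case: (chi a b d); case: (chi a b e);
case: (chi a d e); case: (chi a c e); case: (chi a c d) => //= H1 H2 H3 H4 H5 H6;
solve [by case: (H1 erefl) | by case: (H2 erefl) | by case: (H3 erefl)
      | by case: (H4 erefl) | by case: (H5 erefl) | by case: (H6 erefl)].
Qed.

Section Rchi.
Variables (T : Type) (chi : T -> T -> T -> sg).

Lemma rchi_alt eps : alternating chi -> alternating (rchi eps chi).
Proof.
move=> [A1 A2]; split=> x y z; rewrite /rchi ?[chi y x z]A1 ?[chi x z y]A2;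
by case: (eps x); case: (eps y); case: (eps z); case: (chi x y z).
Qed.

Lemma rchi_gp3 eps : gp3 chi -> gp3 (rchi eps chi).
Proof.
move=> H a b c d e; have := H a b c d e.
have E x y z t u : smul (rchi eps chi x y z) (rchi eps chi x t u) =
    sflip (eps y (+) eps z (+) eps t (+) eps u) (smul (chi x y z) (chi x t u)).
  rewrite /rchi; case: (eps x); case: (eps y); case: (eps z); case: (eps t); case: (eps u);
  by case: (chi x y z); case: (chi x t u).
rewrite !E; case: (eps b); case: (eps c); case: (eps d); case: (eps e) => //=;
by case: (smul _ _); case: (smul _ _); case: (smul _ _).
Qed.

Lemma rchi_is0 eps x y z : is0 (rchi eps chi x y z) = is0 (chi x y z).
Proof. by rewrite /rchi; case: (eps x); case: (eps y); case: (eps z); case: (chi x y z). Qed.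

Lemma rchi_add eps eps' x y z :
  rchi eps (rchi eps' chi) x y z = rchi (fun x => eps x (+) eps' x) chi x y z.
Proof.
rewrite /rchi.
by case: (eps x); case: (eps y); case: (eps z); case: (eps' x); case: (eps' y); case: (eps' z); case: (chi x y z).
Qed.

Lemma posord_rchi P eps : posord P (rchi eps chi) <-> posord P chi.
Proof.
split=> -[rk [e [I H]]].
  exists rk, (fun x => e x (+) eps x); split=> // x y z Px Py Pz xy yz.
  by rewrite -rchi_add; apply: H.
exists rk, (fun x => e x (+) eps x); split=> // x y z Px Py Pz xy yz.
rewrite rchi_add; have := H x y z Px Py Pz xy yz; rewrite /rchi.
by case: (eps x); case: (eps y); case: (eps z); case: (e x); case: (e y); case: (e z); case: (chi x y z).
Qed.

End Rchi.

Section Alt.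
Variables (T : Type) (chi : T -> T -> T -> sg).
Hypothesis A : alternating chi.

Lemma chi_swap12 x y z : chi y x z = sopp (chi x y z). Proof. by case: A. Qed.
Lemma chi_swap23 x y z : chi x z y = sopp (chi x y z). Proof. by case: A. Qed.
Lemma chi_swap13 x y z : chi z y x = sopp (chi x y z).
Proof. by rewrite chi_swap12 chi_swap23 chi_swap12; case: (chi x y z). Qed.
Lemma chi_rot x y z : chi y z x = chi x y z.
Proof. by rewrite chi_swap23 chi_swap12; case: (chi x y z). Qed.
Lemma chi_eq12 x z : chi x x z = Sg0.
Proof. by have := chi_swap12 x x z; case: (chi x x z). Qed.
Lemma chi_eq23 x z : chi z x x = Sg0.
Proof. by rewrite -chi_rot chi_eq12. Qed.
Lemma chi_eq13 x z : chi x z x = Sg0.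
Proof. by rewrite chi_rot chi_eq12. Qed.

(* Rotating a nonnegative order keeps it nonnegative because the rank is odd. *)
Lemma posfor_rotate (P : pred T) rk a : P a ->
  (forall x y, P x -> P y -> rk x = rk y -> x = y) -> posfor P rk chi ->
  (exists N, forall x, P x -> rk x < N) ->
  exists N, let rk' x := if rk x < rk a then rk x + N else rk x in
    [/\ forall x y, P x -> P y -> rk' x = rk' y -> x = y,
        posfor P rk' chi, forall x, P x -> rk' a <= rk' x & forall x, P x -> rk x < N].
Proof.
move=> Pa I H [N hN]; exists N => rk'; split.
- move=> x y Px Py; rewrite /rk'; have := hN x Px; have := hN y Py => h1 h2 h.
  apply: I => //; move: h; case: ifP; case: ifP; lia.
- move=> x y z Px Py Pz; rewrite /rk'.
  have := hN x Px; have := hN y Py; have := hN z Pz => h1 h2 h3.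
  case: ifP => hx; case: ifP => hy; case: ifP => hz xy yz.
  all: try (by apply: H => //; lia).
  all: try lia.
  + by rewrite -(chi_rot x y z); apply: H => //; lia.
  + by rewrite (chi_rot z x y); apply: H => //; lia.
- by move=> x Px; rewrite /rk' ltnn; case: ifP => //; have := hN a Pa; lia.
- exact: hN.
Qed.

End Alt.

(** * Search over partial chirotopes *)

(* [has] and [all] with [if], so that [vm_compute] stops early. *)
Fixpoint hasb (T : Type) (f : T -> bool) s :=
  if s is x :: s' then if f x then true else hasb f s' else false.
Fixpoint allb (T : Type) (f : T -> bool) s :=
  if s is x :: s' then if f x then allb f s' else false else true.

Lemma hasbE (T : Type) (f : T -> bool) s : hasb f s = has f s.
Proof. by elim: s => //= x s ->; case: (f x). Qed.
Lemma allbE (T : Type) (f : T -> bool) s : allb f s = all f s.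
Proof. by elim: s => //= x s ->; case: (f x). Qed.

(* [tbl] stores a partially known chirotope, all orderings of a triple at once. *)
Definition tbl := seq (seq (seq (option sg))).
Definition look (a : tbl) i j k := nth None (nth [::] (nth [::] a i) j) k.
Definition upd1 (a : tbl) i j k v : tbl :=
  let r := nth [::] a i in
  set_nth [::] a i (set_nth [::] r j (set_nth None (nth [::] r j) k (Some v))).
Definition upd (a : tbl) i j k v : tbl :=
  let w := sopp v in
  upd1 (upd1 (upd1 (upd1 (upd1 (upd1 a i j k v) j k i v) k i j v) i k j w) k j i w) j i k w.

Definition sound (X : nat -> nat -> nat -> sg) (a : tbl) :=
  forall i j k v, look a i j k = Some v -> X i j k = v.

Lemma sound_nil X : sound X [::].
Proof. by move=> i j k v; rewrite /look !nth_nil. Qed.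

Lemma sound_upd1 X a i j k v : sound X a -> X i j k = v -> sound X (upd1 a i j k v).
Proof.
move=> S E i' j' k' v'; rewrite /look /upd1 nth_set_nth /=.
case: eqP => [-> | _]; last exact: S.
rewrite nth_set_nth /=; case: eqP => [-> | _]; last exact: S.
by rewrite nth_set_nth /=; case: eqP => [-> [] <- | _]; last exact: S.
Qed.

Lemma sound_upd X a i j k : alternating X -> sound X a -> sound X (upd a i j k (X i j k)).
Proof.
move=> A S; have U := @sound_upd1 X.
have S1 := U _ i j k _ S erefl; have S2 := U _ j k i _ S1 (chi_rot A i j k).
have S3 := U _ k i j _ S2 (esym (chi_rot A k i j)).
have S4 := U _ i k j _ S3 (chi_swap23 A i j k).
exact: U _ j i k _ (U _ k j i _ S4 (chi_swap13 A i j k)) (chi_swap12 A i j k).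
Qed.

Definition trip := (nat * nat * nat)%type.

Definition quint := (nat * nat * nat * nat * nat)%type.
(** An unknown value imposes no condition, so an empty list of orders already refutes orderability
    on a partial table. *)
Definition okin (a : tbl) (p q r : nat * bool) :=
  if look a p.1 q.1 r.1 is Some v
  then nneg (sflip p.2 (sflip q.2 (sflip r.2 v))) else true.
Fixpoint pairb (T : Type) (f : T -> T -> bool) s :=
  if s is x :: s' then if allb (f x) s' then pairb f s' else false else true.
(** Only triples containing [x] are tested; the others were tested at earlier insertions. *)
Definition fits (a : tbl) (u : seq (nat * bool)) x v :=
  if allb (fun p => allb (fun q => okin a p x q) v) u then
    if pairb (fun p q => okin a p q x) u then pairb (fun p q => okin a x p q) v
    else false
  else false.
(* Nothing is inserted before the first entry of a list: a nonnegative order can be rotated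
   to start at any given point. *)
Fixpoint inserts (a : tbl) (u v : seq (nat * bool)) x : seq (seq (nat * bool)) :=
  let r := if v is y :: v' then inserts a (rcons u y) v' x else [::] in
  if fits a u x v then (u ++ x :: v) :: r else r.
Fixpoint builds (a : tbl) (pts : seq nat) (ls : seq (seq (nat * bool))) :=
  if pts is x :: pts' then
    builds a pts' (flatten [seq (if l is h :: t then
       inserts a [:: h] t (x, false) ++ inserts a [:: h] t (x, true) else [::]) | l <- ls])
  else ls.
Definition orders (a : tbl) (pts : seq nat) :=
  if pts is x :: pts' then builds a pts' [:: [:: (x, false)]; [:: (x, true)]] else [::].

Section Complete.
Variables (X : nat -> nat -> nat -> sg) (a : tbl) (rk : nat -> nat) (eps : nat -> bool).
Hypothesis S : sound X a.

Definition sgn x := (x, eps x).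

Lemma inserts_mem x u w v : fits a (u ++ w) x v ->
  (u ++ w) ++ x :: v \in inserts a u (w ++ v) x.
Proof.
elim: w u => [|y w IH] u.
  by rewrite cats0 => F; case: v F => [|y v] /= ->; rewrite in_cons eqxx.
rewrite -cat_rcons => /IH; rewrite cat_rcons /=.
by case: ifP => // _; rewrite in_cons orbC => ->.
Qed.

Lemma pairbE (T : Type) (f : T -> T -> bool) s : pairb f s = pairwise f s.
Proof. by elim: s => //= x s ->; rewrite allbE; case: all. Qed.

Variable P : pred nat.
Hypotheses (I : forall x y, P x -> P y -> rk x = rk y -> x = y)
  (pos : posfor P rk (rchi eps X)).

Lemma okin_complete x y z :
  P x -> P y -> P z -> rk x < rk y -> rk y < rk z -> okin a (sgn x) (sgn y) (sgn z).
Proof.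
move=> Px Py Pz xy yz; rewrite /okin /=; case E: look => [v|] //.
by rewrite -(@S _ _ _ _ E); apply: pos.
Qed.

Let lt x y := rk x < rk y.

Lemma sorted_split x w : P x -> all P w -> pairwise lt w -> x \notin w ->
  exists u v, [/\ w = u ++ v, all (lt^~ x) u & all (lt x) v].
Proof.
move=> Px; elim: w => [|y w IH] /=; first by exists [::], [::].
case/andP=> Py Pw /andP[yw /(IH Pw){}IH]; rewrite in_cons negb_or => /andP[/eqP xy /IH].
case=> u [v [E U V]]; case: (ltnP (rk y) (rk x)) => h.
  by exists (y :: u), v; rewrite /= E U {1}/lt h.
have {}h : lt x y.
  by rewrite /lt ltn_neqAle h andbT; apply/eqP => /(I Px Py).
exists [::], (y :: w); split=> //=; rewrite h; apply/allP => z /(allP yw).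
exact: ltn_trans.
Qed.

Lemma fits_complete u x v : all P u -> P x -> all P v -> pairwise lt (u ++ v) ->
  all (lt^~ x) u -> all (lt x) v -> fits a (map sgn u) (sgn x) (map sgn v).
Proof.
move=> /allP Pu Px /allP Pv; rewrite pairwise_cat => /and3P[_ su sv] /allP U /allP V.
rewrite /fits !allbE !pairbE !pairwise_map.
have -> : all (fun p => allb (fun q => okin a p (sgn x) q) (map sgn v)) (map sgn u).
  rewrite all_map; apply/allP => y yu /=; rewrite allbE all_map; apply/allP => z zv /=.
  by apply: okin_complete; [exact: Pu | | exact: Pv | exact: U | exact: V].
have -> : pairwise (relpre sgn (fun p q => okin a p q (sgn x))) u.
  apply: (@sub_in_pairwise _ (mem u) lt _ _ u _ su) => [y z yu zu yz|]; last exact/allP.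
  by apply: okin_complete => //; [exact: Pu| exact: Pu| exact: U].
apply: (@sub_in_pairwise _ (mem v) lt _ _ v _ sv) => [y z yv zv yz|]; last exact/allP.
by apply: okin_complete => //; [exact: Pv| exact: Pv| exact: V].
Qed.

(** The invariant is that [ls] contains the given order restricted to the points inserted so far. As
    [h] is minimal, no later point has to go before it. *)
Lemma builds_complete pts h t ls : map sgn (h :: t) \in ls ->
  uniq (h :: t ++ pts) -> all P (h :: t ++ pts) -> pairwise lt (h :: t) ->
  (forall x, x \in pts -> lt h x) ->
  exists2 w, map sgn w \in builds a pts ls &
    perm_eq w (h :: t ++ pts) /\ pairwise lt w.
Proof.
elim: pts t ls => [|x pts IH] t ls /= inls uq Pall sw hmin.
  by exists (h :: t); rewrite ?cats0.
have [u [v [E U V]]] : exists u v, [/\ t = u ++ v, all (lt^~ x) u & all (lt x) v].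
  move: uq Pall sw; rewrite /= !all_cat !mem_cat !cat_uniq /=.
  case/and5P=> _ _ /norP[xt _] _ _ /and4P[_ Pt Px _] /andP[_ st].
  exact: sorted_split.
have pe : perm_eq (h :: (u ++ x :: v) ++ pts) (h :: t ++ x :: pts).
  by rewrite E perm_cons -!catA perm_cat2l perm_sym -cat1s perm_catCA.
have uq' : uniq (h :: (u ++ x :: v) ++ pts) by rewrite (perm_uniq pe).
have Pall' : all P (h :: (u ++ x :: v) ++ pts) by rewrite (perm_all _ pe).
have sw' : pairwise lt (h :: (u ++ x :: v)).
  move: sw; rewrite E /= !pairwise_cat /= !all_cat !allrel_consr U V /=.
  case/andP=> /andP[-> ->] /and3P[-> -> ->].
  by rewrite hmin ?mem_head.
have fits' : fits a (map sgn (h :: u)) (sgn x) (map sgn v).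
  move: Pall'; rewrite /= !all_cat /= => /and3P[Ph /and3P[Pu Px Pv] _].
  apply: (@fits_complete (h :: u) x v) => //=; first by rewrite Ph.
    by move: sw; rewrite E.
  by rewrite hmin ?mem_head.
set ls' := flatten _.
have inls' : map sgn (h :: (u ++ x :: v)) \in ls'.
  apply/flattenP; exists (inserts a [:: sgn h] (map sgn t) (x, false) ++
                          inserts a [:: sgn h] (map sgn t) (x, true)).
    by apply/mapP; exists (map sgn (h :: t)).
  have key c : eps x = c ->
      map sgn (h :: (u ++ x :: v)) \in inserts a [:: sgn h] (map sgn t) (x, c).
    by move=> <-; rewrite E /= !map_cat; apply: (@inserts_mem (sgn x) [:: sgn h] (map sgn u)).
  by rewrite mem_cat; case Ex: (eps x); rewrite (key _ Ex) ?orbT.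
have hmin' z : z \in pts -> lt h z by move=> zp; apply: hmin; rewrite in_cons zp orbT.
case: (IH _ _ inls' uq' Pall' sw' hmin') => w wls [pw sw''].
by exists w => //; split=> //; apply: perm_trans pw pe.
Qed.

Lemma orders_complete h pts : uniq (h :: pts) -> all P (h :: pts) ->
  (forall x, x \in pts -> rk h < rk x) ->
  exists2 w, map sgn w \in orders a (h :: pts) &
    perm_eq w (h :: pts) /\ pairwise lt w.
Proof.
move=> uq Pall hmin; apply: (@builds_complete pts h [::]) => //=.
by rewrite /sgn !in_cons; case: (eps h); rewrite eqxx ?orbT.
Qed.

End Complete.

(** The largest entry varies slowest: all values on the first points are known before a new point
    enters. *)
Definition trips n : seq trip :=
  flatten [seq flatten [seq [seq (i, j, k) | i <- iota 0 j] | j <- iota 0 k] | k <- iota 0 n].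

Definition gpok (a : tbl) (q : quint) :=
  let: (x, b, c, d, e) := q in
  if look a x b c is Some s1 then if look a x d e is Some s2 then
  if look a x b d is Some s3 then if look a x c e is Some s4 then
  if look a x b e is Some s5 then if look a x c d is Some s6 then
    cancel3 (smul s1 s2) (sopp (smul s3 s4)) (smul s5 s6)
  else true else true else true else true else true else true.

(** Rejects four points on a line. *)
Definition c4ok (a : tbl) (q : trip * nat) :=
  let: (x, y, z, t) := q in
  if look a x y z is Some Sg0 then if look a x y t is Some Sg0 then false else true else true.

(* The relations for which [t] is the last triple in the order of [trips]. *)
Definition gps (t : trip) :=
  let: (i, j, k) := t in
  let pairs n := flatten [seq [seq (p, q) | p <- iota 0 q] | q <- iota 0 n] in
  [seq (i, j, k, r.1, r.2) | r <- pairs j & (r.1 != i) && (r.2 != i)] ++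
  flatten [seq [:: (j, i, k, r.1, r.2); (k, i, j, r.1, r.2)] | r <- pairs i].
Definition c4s (t : trip) :=
  let: (i, j, k) := t in
  [seq (i, j, k, p) | p <- iota 0 k & (p != i) && (p != j)] ++
  [seq (i, k, j, p) | p <- iota 0 j & p != i] ++ [seq (j, k, i, p) | p <- iota 0 i].

Definition rem_pt n j := [seq x <- iota 0 n | x != j].

(* A step assigns a value to a triple and then tests the relations that it completes,
   and the nonnegative orderability of the listed sets of points. *)
Definition step := (trip * seq quint * seq (trip * nat) * seq (seq nat))%type.
Definition chk (a : tbl) (s : step) :=
  let: (_, g, c, o) := s in
  if allb (c4ok a) c then if allb (gpok a) g then
    allb (fun pts => if orders a pts is [::] then false else true) o else false else false.

(** The points below [m] are in a nonnegative order, so their values are not negative. For a later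
    point [k], reorienting [k] makes one value nonnegative; [j == 1] selects the triple [(0, 1, k)]
    for this. *)
Fixpoint search (leaf : tbl -> bool) (m : nat) (steps : seq step) (a : tbl) : bool :=
  if steps is s :: r then
    let: (i, j, k, _, _, _) := s in
    allb (fun v => let a' := upd a i j k v in
                   if chk a' s then search leaf m r a' else true)
         (if (k < m) || (j == 1) then [:: SgP; Sg0] else [:: SgP; Sg0; SgN])
  else leaf a.

(** The branch that follows the values of [X] is never pruned, and it ends in a leaf. *)
Lemma searchP X leaf m n steps a :
  alternating X -> search leaf m steps a -> sound X a ->
  (forall i j k, i < j -> j < k -> k < n -> (k < m) || (j == 1) -> nneg (X i j k)) ->
  all (fun s : step => let: (i, j, k, _, _, _) := s in [&& i < j, j < k & k < n]) steps ->
  (forall a s, sound X a -> List.In s steps -> chk a s) ->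
  exists2 a', sound X a' & leaf a'.
Proof.
move=> A + + pos; elim: steps a => [|s r IH] a.
  by exists a.
rewrite /=; case: s => -[[[[i j] k] g] c] o H S /andP[/and3P[ij jk kn] wf] chks.
have S1 : sound X (upd a i j k (X i j k)) by exact (@sound_upd X a i j k A S).
have chkOK := chks _ _ S1 (or_introl erefl).
apply: (IH _ _ S1 wf) => [|a1 i1 Sa1 i1r]; last by apply: chks => //; right.
move: chkOK H (pos i j k ij jk kn); case: (_ || _) => /=.
  case: (X i j k) => c'; rewrite ?c'.
  - by case: ifP => // _; case: ifP.
  - by case: ifP.
  - by move=> _ /(_ isT).
case: (X i j k) => c'; rewrite c' => + _.
- by case: ifP => // _; case: ifP.
- by case: ifP.
- by case: ifP => // _; case: ifP => // _; case: ifP.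
Qed.

Definition steps (n : nat) (o : trip -> seq (seq nat)) : seq step :=
  [seq (t, gps t, c4s t, o t) | t <- trips n].
Definition steps7 := Eval vm_compute in steps 7 (fun _ => [::]).
(* For eight points the orderability of {0,..,5,7} is tested once its triples are known. *)
Definition steps8 := Eval vm_compute in
  steps 8 (fun t => if t == (4, 5, 7) then [:: rem_pt 8 6] else [::]).

(** Here an unknown value counts as a failure, in contrast to [okin]: a list that passes certifies
    an order. *)
Definition good (a : tbl) n (l : seq (nat * bool)) :=
  let s := unzip1 l in
  let e x := nth false (unzip2 l) (index x s) in
  if allb (mem s) (iota 0 n) then
    allb (fun x => allb (fun y => allb (fun z =>
      if index x s < index y s then if index y s < index z s then
        if look a x y z is Some v then nneg (sflip (e x) (sflip (e y) (sflip (e z) v))) else false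
      else true else true) (iota 0 n)) (iota 0 n)) (iota 0 n)
  else false.

Definition leaf n a :=
  if hasb (fun j => nilp (orders a (rem_pt n j))) (iota 0 n) then true
  else hasb (good a n) (orders a (iota 0 n)).

(** The second list is the reversal with 0 kept first. Reversing a triple is an odd permutation, and
    reorienting all points makes up for it. *)
Definition unique7 a :=
  allb (fun l => (l == [seq (x, false) | x <- iota 0 7]) ||
                 (l == [seq (x, true) | x <- 0 :: rev (iota 1 6)])) (orders a (iota 0 7)).

(** What [wf_chk] and [searchP] need to know about a step. By the last clause each tested set of
    points misses some [j], hence lies in a deletion. *)
Definition wf_step n (s : step) :=
  let: (i, j, k, _, c, o) := s in
  [&& i < j, j < k, k < n,
      all (fun q : trip * nat => let: (x, y, z, t) := q in
             uniq [:: x; y; z; t] && all (fun p => p < n) [:: x; y; z; t]) c &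
      all (fun pts => [&& pts != [::], uniq pts & has (fun j => 
             all (fun p => (p < n) && (p != j)) pts) (iota 0 n)]) o].

(** The bound is one less than the number of points when the order comes from a deletion, and 7 in
    [search_unique7], where all seven points are ordered. *)
Lemma search_leaf7 : search (leaf 7) 6 steps7 [::].
Proof. by vm_cast_no_check (erefl true). Qed.
Lemma search_leaf8 : search (leaf 8) 7 steps8 [::].
Proof. by vm_cast_no_check (erefl true). Qed.
Lemma search_unique7 : search unique7 7 steps7 [::].
Proof. by vm_cast_no_check (erefl true). Qed.
Lemma wf_steps7 : all (wf_step 7) steps7. Proof. by vm_cast_no_check (erefl true). Qed.
Lemma wf_steps8 : all (wf_step 8) steps8. Proof. by vm_cast_no_check (erefl true). Qed.

(** * Seven and eight points *)

(** Rotation brings any chosen point to the front. Passing to a list bounds the ranks, as the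
    rotation requires. *)
Lemma posord_min (T : eqType) (s : seq T) (P : pred T) chi h : alternating chi ->
  posord P chi -> all P s -> h \in s ->
  exists rk eps, [/\ forall x y, x \in s -> y \in s -> rk x = rk y -> x = y,
    posfor (mem s) rk (rchi eps chi) & forall x, x \in s -> rk h <= rk x].
Proof.
move=> A [rk [eps [I H]]] /allP Ps hs.
have A' := rchi_alt eps A.
have I1 x y : mem s x -> mem s y -> rk x = rk y -> x = y by move=> /Ps Px /Ps Py; apply: I.
have H1 : posfor (mem s) rk (rchi eps chi).
  by move=> x y z /Ps Px /Ps Py /Ps Pz; apply: H.
have [|N [I' H' M _]] := posfor_rotate A' (hs : mem s h) I1 H1.
  exists (\max_(x <- s) rk x).+1 => x xs; rewrite ltnS.
  elim: s xs {Ps hs I1 H1} => //= y s IH; rewrite in_cons big_cons => /orP[/eqP->|/IH h'].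
    exact: leq_maxl.
  by apply: leq_trans h' _; exact: leq_maxr.
by exists (fun x => if rk x < rk h then rk x + N else rk x), eps.
Qed.

Section Finite.
Variables (X : nat -> nat -> nat -> sg) (n : nat).
Hypotheses (A : alternating X) (G : gp3 X).
Hypothesis c4 : forall x y z t, uniq [:: x; y; z; t] ->
  all (fun p => p < n) [:: x; y; z; t] -> is0 (X x y z) -> is0 (X x y t) -> False.

Lemma orders_neq0 a P pts : sound X a -> posord P X -> uniq pts -> all P pts ->
  pts != [::] -> orders a pts != [::].
Proof.
case: pts => // h pts S pP uq al _.
have [|rk [eps [I H M]]] := posord_min A pP al (h := h); first exact: mem_head.
have := @orders_complete X a rk eps S (mem (h :: pts)) I H h pts uq.
have -> : all (mem (h :: pts)) (h :: pts) by apply/allP.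
case=> // [x xp | w]; last by case: orders.
rewrite ltn_neqAle M ?in_cons ?xp ?orbT // andbT; apply/eqP => /I.
by rewrite mem_head in_cons xp orbT => /(_ isT isT) E; move: uq; rewrite /= E xp.
Qed.

Lemma wf_chk a s : sound X a -> wf_step n s ->
  (forall j, j < n -> posord (fun x => (x < n) && (x != j)) X) -> chk a s.
Proof.
move=> S; case: s => -[[[[i j] k] g] c] o /= /and5P[_ _ _ wc wo] po.
have -> : allb (c4ok a) c.
  rewrite allbE; apply: sub_all wc => -[[[x y] z] t] /andP[u l] /=.
  case E: look => [[||]|] //; case E': look => [[||]|] //.
  by case: (c4 u l); rewrite ?(S _ _ _ _ E) ?(S _ _ _ _ E').
have -> : allb (gpok a) g.
  rewrite allbE; apply/allP => -[[[[x b] c'] d] e] _ /=.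
  case E1: look => [?|] //; case E2: look => [?|] //; case E3: look => [?|] //.
  case E4: look => [?|] //; case E5: look => [?|] //; case E6: look => [?|] //.
  rewrite -(S _ _ _ _ E1) -(S _ _ _ _ E2) -(S _ _ _ _ E3).
  by rewrite -(S _ _ _ _ E4) -(S _ _ _ _ E5) -(S _ _ _ _ E6).
rewrite allbE; apply: sub_all wo => pts /and3P[n0 uq /hasP[l]].
rewrite mem_iota => /= /po pl al; have := orders_neq0 S pl uq al n0.
by case: orders.
Qed.

Lemma good_posord a l : sound X a -> good a n l -> posord (fun x => x < n) X.
Proof.
move=> S; rewrite /good allbE; case: ifP => // /allP sub.
rewrite allbE => /allP H.
have mi x : x < n -> x \in iota 0 n by rewrite mem_iota.
exists (index^~ (unzip1 l)).
exists (fun x => nth false (unzip2 l) (index x (unzip1 l))); split.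
  by move=> x y /mi /sub xs /mi /sub ys; apply: index_inj xs ys.
move=> x y z xn yn zn xy yz.
have := H _ (mi _ xn); rewrite allbE => /allP /(_ _ (mi _ yn)).
rewrite allbE => /allP /(_ _ (mi _ zn)); rewrite xy yz.
by case E: look => [v|] // h; rewrite /rchi (S _ _ _ _ E).
Qed.

Lemma leaf_posord a : sound X a -> leaf n a -> 0 < n ->
  (forall j, j < n -> posord (fun x => (x < n) && (x != j)) X) ->
  1 < n -> posord (fun x => x < n) X.
Proof.
move=> S + n0 po n1; rewrite /leaf !hasbE; case: ifP => [/hasP[j jn] no _|_].
  rewrite mem_iota in jn.
  suff : orders a (rem_pt n j) != [::] by case: orders no.
  apply: (orders_neq0 S (po j jn)).
  - by rewrite filter_uniq // iota_uniq.
  - by apply/allP => x; rewrite mem_filter mem_iota /= andbC.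
  (* The boolean read as a number is 1 if [j] is 0 and 0 otherwise, so it differs from [j]. *)
  - apply/eqP => E; have : (j == 0 : nat) \in rem_pt n j.
      by rewrite mem_filter mem_iota; case: (j) => [|j'] //=; rewrite ?n1 ?n0.
    by rewrite E.
by case/hasP => l _; apply: good_posord.
Qed.

End Finite.

Lemma wf_order n (s : seq step) : all (wf_step n) s ->
  all (fun s : step => let: (i, j, k, _, _, _) := s in [&& i < j, j < k & k < n]) s.
Proof. by apply: sub_all => -[[[[[i j] k] g] c] o] /and5P[-> -> ->]. Qed.

Lemma all_In (T : Type) (P : pred T) s x : all P s -> List.In x s -> P x.
Proof. by elim: s => //= y s IH /andP[Py /IH h] [<-|/h]. Qed.

Lemma posord_7_8 (X : nat -> nat -> nat -> sg) n : (n == 7) || (n == 8) ->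
  alternating X -> gp3 X ->
  (forall x y z t, uniq [:: x; y; z; t] -> all (fun p => p < n) [:: x; y; z; t] ->
     is0 (X x y z) -> is0 (X x y t) -> False) ->
  (forall i j k, i < j -> j < k -> k < n -> (k < n.-1) || (j == 1) -> nneg (X i j k)) ->
  (forall j, j < n -> posord (fun x => (x < n) && (x != j)) X) ->
  posord (fun x => x < n) X.
Proof.
move=> n78 A G c4 pos po.
case/orP: n78 => /eqP En; subst n.
  have [a Sa La] := searchP A search_leaf7 (@sound_nil X) pos (wf_order wf_steps7)
    (fun a s Sa si => wf_chk A G c4 Sa (all_In wf_steps7 si) po).
  by apply: (leaf_posord A Sa La).
have [a Sa La] := searchP A search_leaf8 (@sound_nil X) pos (wf_order wf_steps8)
  (fun a s Sa si => wf_chk A G c4 Sa (all_In wf_steps8 si) po).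
by apply: (leaf_posord A Sa La).
Qed.

(** The second alternative is the reversal; only its effect on nonzero points is kept, which
    suffices to exclude it once the order of two of them is prescribed. *)
Lemma order_unique7 (X : nat -> nat -> nat -> sg) rk eps :
  alternating X -> gp3 X ->
  (forall x y z t, uniq [:: x; y; z; t] -> all (fun p => p < 7) [:: x; y; z; t] ->
     is0 (X x y z) -> is0 (X x y t) -> False) ->
  posfor (fun x => x < 7) id X ->
  (forall x y, x < 7 -> y < 7 -> rk x = rk y -> x = y) ->
  posfor (fun x => x < 7) rk (rchi eps X) ->
  (forall x, 0 < x < 7 -> rk 0 < rk x) ->
  (forall x, x < 7 -> eps x = false) /\ (forall x y, x < y -> y < 7 -> rk x < rk y) \/
  (forall x y, 0 < x -> x < y -> y < 7 -> rk y < rk x).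
Proof.
move=> A G c4 pos I H M.
have po j : j < 7 -> posord (fun x => (x < 7) && (x != j)) X.
  move=> _; exists id, (fun=> false); split=> // x y z /andP[x7 _] /andP[y7 _] /andP[z7 _].
  exact: pos.
have pos' i j k : i < j -> j < k -> k < 7 -> (k < 7) || (j == 1) -> nneg (X i j k).
  by move=> ij jk k7 _; apply: pos => //; lia.
have [a S U] := searchP A search_unique7 (@sound_nil X) pos' (wf_order wf_steps7)
  (fun a s Sa si => wf_chk A G c4 Sa (all_In wf_steps7 si) po).
have [//||x|w wl [_ W]] := @orders_complete X a rk eps S (fun x => x < 7) I H 0 (iota 1 6) => //.
  by rewrite mem_iota => x17; apply: M; lia.
have W0 : unzip1 (map (sgn eps) w) = w by rewrite /unzip1 -map_comp map_id.
move: U; rewrite /unique7 allbE => /allP /(_ _ wl) /orP[] /eqP E.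
  left; have wE : w = iota 0 7.
    by rewrite -W0 E.
  split=> [x x7|x y xy y7].
    by move: E; rewrite wE /= => -[]; case: x x7 => [|[|[|[|[|[|[|x]]]]]]].
  have := pairwiseP 0 W x y; rewrite wE !inE size_iota !nth_iota //; last lia.
  by apply=> //; lia.
right=> x y x0 xy y7; have wE : w = 0 :: rev (iota 1 6).
  by rewrite -W0 E.
(* In the reversed list a point [x > 0] stands at position [7 - x]. *)
have := pairwiseP 0 W; rewrite wE => /(_ (7 - y) (7 - x)).
by rewrite !inE; case: x x0 xy => [|[|[|[|[|[|[|x]]]]]]] //;
  case: y y7 => [|[|[|[|[|[|[|y]]]]]]] //= _ _ _; apply.
Qed.

Lemma posord_comp (T T' : Type) (f : T' -> T) (P : pred T) (P' : pred T') chi :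
  (forall x, P' x -> P (f x)) -> (forall x y, P' x -> P' y -> f x = f y -> x = y) ->
  posord P chi -> posord P' (fun x y z => chi (f x) (f y) (f z)).
Proof.
move=> PP fI [rk [eps [I H]]]; exists (rk \o f), (eps \o f); split.
  by move=> x y Px Py /I h; apply: fI => //; apply: h; apply: PP.
by move=> x y z /PP Px /PP Py /PP Pz; apply: H.
Qed.

Lemma eq_posord (T : Type) (P : pred T) chi chi' :
  (forall x y z, P x -> P y -> P z -> chi x y z = chi' x y z) ->
  posord P chi -> posord P chi'.
Proof.
move=> E [rk [eps [I H]]]; exists rk, eps; split=> // x y z Px Py Pz.
by rewrite /rchi -E //; apply: H.
Qed.

Lemma rk_sorted_enum (E : finType) (H : {set E}) (rk : E -> nat) :
  (forall x y, x \in H -> y \in H -> rk x = rk y -> x = y) ->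
  exists s, [/\ uniq s, s =i H &
    forall d i j, i < j -> j < size s -> rk (nth d s i) < rk (nth d s j)].
Proof.
move=> I; pose le x y := rk x <= rk y; exists (sort le (enum H)).
have u : uniq (sort le (enum H)) by rewrite sort_uniq enum_uniq.
have m : sort le (enum H) =i H by move=> x; rewrite mem_sort mem_enum.
have pw : pairwise le (sort le (enum H)).
  rewrite -sorted_pairwise; last by move=> y x z; apply: leq_trans.
  by apply: sort_sorted => x y; apply: leq_total.
split=> // d i j ij js; have si := ltn_trans ij js.
have /= h : rk _ <= rk _ := pairwiseP d pw i j si js ij; rewrite ltn_neqAle {}h andbT; apply/eqP => /I.
by rewrite -!m !mem_nth // => /(_ isT isT) /eqP; rewrite nth_uniq //; lia.
Qed.

Section Core.
Variables (E : finType) (G : {set E}) (chi : E -> E -> E -> sg).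
Hypotheses (A : alternating chi) (GP : gp3 chi).

Lemma posord_card_7_8 : (#|G| == 7) || (#|G| == 8) ->
  (forall x y z t, uniq [:: x; y; z; t] -> all (fun p => p \in G) [:: x; y; z; t] ->
     is0 (chi x y z) -> is0 (chi x y t) -> False) ->
  (forall e, e \in G -> posord (fun x => x \in G :\ e) chi) ->
  posord (fun x => x \in G) chi.
Proof.
move=> n78 c4 po.
have [e eG] : exists e, e \in G by apply/card_gt0P; move: n78 => /orP[] /eqP->.
have [rk [eps [I H]]] := po e eG.
have [s [us ms lts]] := rk_sorted_enum I.
pose n := #|G|.
have sn : size s = n.-1.
  by rewrite /n (cardsD1 e G) eG -(card_uniqP us); apply: eq_card.
have n7 : 6 < n by move: n78; rewrite /n => /orP[] /eqP->.
pose p := rcons s e.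
have sp : size p = n by rewrite size_rcons sn; lia.
have mp : p =i G by move=> x; rewrite mem_rcons in_cons ms in_setD1; case: eqP => // ->.
have up : uniq p by rewrite rcons_uniq us ms in_setD1 eqxx.
pose f i := nth e p i.
have fs i : i < n.-1 -> f i = nth e s i.
  by move=> h; rewrite /f nth_rcons sn h.
have fe : f n.-1 = e by rewrite /f nth_rcons sn ltnn eqxx.
have fG i : i < n -> f i \in G by move=> h; rewrite -mp mem_nth // sp.
have fse i : i < n.-1 -> f i \in G :\ e by move=> h; rewrite fs // -ms mem_nth // sn.
have fI i j : i < n -> j < n -> f i = f j -> i = j.
  by move=> hi hj /eqP; rewrite nth_uniq ?sp // => /eqP.
(* The order on the other points says nothing about [e], which gets the last index. Its sign is
   chosen to make the triple of the first two points and [e] nonnegative, as the search assumes. *)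
pose b := ~~ nneg (sflip (eps (f 0)) (sflip (eps (f 1)) (chi (f 0) (f 1) e))).
pose eps' x := if x == e then b else eps x.
have epsf i : i < n.-1 -> eps' (f i) = eps (f i).
  by move=> h; rewrite /eps'; move: (fse i h); rewrite in_setD1; case: eqP.
pose X i j k := rchi eps' chi (f i) (f j) (f k).
have A' := rchi_alt eps' A; have GP' := rchi_gp3 eps' GP.
have AX : alternating X by split=> i j k; apply A'.
have GPX : gp3 X by move=> i j k l m; apply: GP'.
have: posord (fun i => i < n) X.
  apply: posord_7_8 => //.
  - move=> x y z t u al; rewrite !rchi_is0; apply: c4.
      rewrite -(map_inj_in_uniq (f := f)) in u; first exact: u.
      by move=> i j /(allP al) hi /(allP al) hj; apply: fI.
    by move: al => /= /and5P[? ? ? ? _]; rewrite !fG.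
  - move=> i j k ij jk kn; case: (ltnP k n.-1) => [kn1 _|kn1 /= /eqP j1].
      rewrite /X /rchi !epsf; try lia.
      by apply: H; rewrite ?fse ?fs ?lts // ?sn //; lia.
    have -> : i = 0 by lia. have -> : k = n.-1 by lia.
    rewrite /X /rchi j1 fe (epsf 0) ?(epsf 1); try lia.
    rewrite /eps' eqxx /b.
    by case: (eps (f 0)); case: (eps (f 1)); case: (chi (f 0) (f 1) e).
  - move=> j jn; apply: (posord_comp (P := fun x => x \in G :\ f j)
      (chi := rchi eps' chi)) => [x /andP[xn xj]|x y /andP[xn _] /andP[yn _]|].
    + by rewrite in_setD1 fG // andbT; apply: contra xj => /eqP /fI -> //.
    + exact: fI.
    + by apply/posord_rchi; apply: po; apply: fG.
move=> po'; apply/(posord_rchi _ _ eps').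
apply: (eq_posord (chi := fun x y z => X (index x p) (index y p) (index z p))).
  by move=> x y z xG yG zG; rewrite /X /f !nth_index // mp.
apply: posord_comp po' => [x xG|x y xG yG]; first by rewrite -sp index_mem mp.
by move: (xG) (yG); rewrite -!mp => xp yp; apply: index_inj xp yp.
Qed.

End Core.

(** * At least nine points *)

Lemma rchi_neg (T : Type) (chi : T -> T -> T -> sg) eps x y z :
  rchi (fun x => ~~ eps x) chi x y z = sopp (rchi eps chi x y z).
Proof.
by rewrite /rchi; case: (eps x); case: (eps y); case: (eps z); case: (chi x y z).
Qed.

Lemma exists_notin (E : finType) (V : {set E}) (s : seq E) :
  size s < #|V| -> exists2 v, v \in V & v \notin s.
Proof.
move=> h; have : 0 < #|V :\: [set x in s]|.
  rewrite cardsD subn_gt0; apply: leq_trans h; rewrite ltnS.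
  apply: leq_trans (subset_leq_card (subsetIr _ _)) _.
  by rewrite cardsE; apply: card_size.
by case/card_gt0P => v; rewrite !inE => /andP[vs vV]; exists v.
Qed.

Lemma set_between (E : finType) (S H : {set E}) k :
  S \subset H -> #|S| <= k <= #|H| -> exists W : {set E}, [/\ S \subset W, W \subset H & #|W| = k].
Proof.
move=> SH /andP[Sk kH]; move E1: (k - #|S|) => d; elim: d S SH Sk E1 => [|d IH] S SH Sk dE.
  by exists S; split=> //; lia.
have [x xH xS] : exists2 x, x \in H & x \notin enum S.
  by apply: exists_notin; rewrite -cardE; lia.
rewrite mem_enum in xS; have cS : #|x |: S| = #|S|.+1 by rewrite cardsU1 xS.
have [|||W [xW WH Wk]] := IH (x |: S); rewrite ?cS; try lia.
  by rewrite subUset sub1set xH.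
by exists W; split=> //; apply: subset_trans xW; apply: subsetUr.
Qed.

Section Normal.
Variables (E : finType) (chi : E -> E -> E -> sg).
Hypotheses (A : alternating chi) (GP : gp3 chi).
Variables (a b c : E).

(** Having [a] first removes the rotations, and [b] before [c] removes the reversal. *)
Definition normal (H : {set E}) rk eps :=
  [/\ forall x y, x \in H -> y \in H -> rk x = rk y -> x = y,
      posfor (fun x => x \in H) rk (rchi eps chi),
      forall x, x \in H -> rk a <= rk x & rk b < rk c].

Lemma exists_normal (H : {set E}) : a \in H -> b \in H -> c \in H -> uniq [:: a; b; c] ->
  posord (fun x => x \in H) chi -> exists rk eps, normal H rk eps.
Proof.
move=> aH bH cH /= /and3P[abc bc _] po.
rewrite !inE negb_or in abc; case/andP: abc => ab ac; rewrite inE in bc.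
have al : all (fun x => x \in H) (enum H) by apply/allP => x; rewrite mem_enum.
have ae : a \in enum H by rewrite mem_enum.
have [rk [eps [I P M]]] := posord_min A po al ae.
have {}I x y : x \in H -> y \in H -> rk x = rk y -> x = y.
  by move=> xH yH; apply: I; rewrite mem_enum.
have {}P : posfor (fun x => x \in H) rk (rchi eps chi).
  by move=> x y z xH yH zH; apply: P => /=; rewrite mem_enum.
have {}M x : x \in H -> rk a <= rk x by move=> xH; apply: M; rewrite mem_enum.
case: (ltnP (rk b) (rk c)) => [bcl|]; first by exists rk, eps.
rewrite leq_eqVlt => /orP[/eqP /(I _ _ cH bH) E1|cb]; first by rewrite E1 eqxx in bc.
have [N hN] : exists N, forall x, rk x < N.
  exists (\max_x rk x).+1 => x; rewrite ltnS; exact: (leq_bigmax (F := rk)).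
have d0 u : 0 < N - rk u by rewrite subn_gt0.
have dlt u v : (N - rk u < N - rk v) = (rk v < rk u) by rewrite (ltn_sub2lE _ (ltnW (hN u))).
have dinj u v : N - rk u = N - rk v -> rk u = rk v.
  by move=> E1; apply/eqP; rewrite eqn_leq (leqNgt (rk u) (rk v)) (leqNgt (rk v) (rk u)) -(dlt u v) -(dlt v u) E1 ltnn.
(* The order is reversed with [a] kept first; all signs change because reversing a triple is odd. *)
exists (fun x => if x == a then 0 else N - rk x), (fun x => ~~ eps x); split.
- move=> x y xH yH; case: eqP => [->|_]; case: eqP => [->|_] // E1.
  + by have := d0 y; rewrite -E1.
  + by have := d0 x; rewrite E1.
  + by apply: I => //; apply: dinj.
- move=> x y z xH yH zH; rewrite rchi_neg -(chi_swap23 (rchi_alt eps A)).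
  case: (z =P a) => // za; case: (y =P a) => // ya; case: (x =P a) => [->|xa];
    rewrite ?dlt => xy yz.
    apply: P => //.
    by rewrite ltn_neqAle M // andbT; apply/eqP => /(I _ _ aH zH) /esym.
  by rewrite -(chi_rot (rchi_alt eps A)); apply: P.
- by move=> x _; rewrite eqxx.
- by rewrite ![_ == a]eq_sym (negbTE ab) (negbTE ac) dlt.
Qed.

(** The orders are compared on a seven-point set containing [a], [b], [c], [x], [y]; the reversal
    there would put [c] before [b]. *)
Lemma normal_agree (H : {set E}) rk1 eps1 rk2 eps2 :
  (forall x y z t, uniq [:: x; y; z; t] -> all (fun p => p \in H) [:: x; y; z; t] ->
     is0 (chi x y z) -> is0 (chi x y t) -> False) ->
  7 <= #|H| -> a \in H -> b \in H -> c \in H -> uniq [:: a; b; c] ->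
  normal H rk1 eps1 -> normal H rk2 eps2 ->
  forall x y, x \in H -> y \in H ->
  (rk1 x < rk1 y -> rk2 x < rk2 y) /\ eps1 x = eps2 x.
Proof.
move=> c4 H7 aH bH cH uabc [I1 P1 M1 L1] [I2 P2 M2 L2] x y xH yH.
have [W [SW WH W7]] : exists W : {set E},
    [/\ [set z in [:: a; b; c; x; y]] \subset W, W \subset H & #|W| = 7].
  apply: set_between.
    apply/subsetP => z; rewrite !inE => /or4P[/eqP->|/eqP->|/eqP->|/orP[]/eqP->] //.
  by rewrite H7 andbT cardsE; apply: leq_trans (card_size _) _.
have inW z : z \in [:: a; b; c; x; y] -> z \in W.
  by move=> h; apply: (subsetP SW); rewrite inE.
have [s [us ms lts]] := rk_sorted_enum (fun z t zW tW =>
  I1 z t (subsetP WH _ zW) (subsetP WH _ tW)).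
have ss : size s = 7 by rewrite -W7 -(card_uniqP us); apply: eq_card.
pose f i := nth a s i.
have fW i : i < 7 -> f i \in W by move=> h; rewrite -ms mem_nth // ss.
have fH i : i < 7 -> f i \in H by move=> /fW; apply: (subsetP WH).
have fI i j : i < 7 -> j < 7 -> f i = f j -> i = j.
  by move=> hi hj /eqP; rewrite nth_uniq ?ss // => /eqP.
have fK z : z \in W -> exists2 i, i < 7 & z = f i.
  by move=> zW; exists (index z s); rewrite -?ss ?index_mem ?ms // /f nth_index ?ms.
have ltf i j : i < j -> j < 7 -> rk1 (f i) < rk1 (f j).
  by move=> ij j7; apply: lts; rewrite ?ss.
have ltf' i j : i < 7 -> rk1 (f i) < rk1 (f j) -> i < j.
  move=> i7; case: (ltngtP i j) => // [ji|->]; last by rewrite ltnn.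
  by rewrite ltnNge (ltnW (ltf _ _ ji i7)).
have f0 : f 0 = a.
  have [i i7 ai] := fK a (inW a (mem_head _ _)).
  case: i i7 ai => [//|i] i7 ai.
  by have := ltf 0 i.+1 isT i7; rewrite -ai ltnNge (M1 _ (fH 0 isT)).
(* Indexed along the first order and reoriented by [eps1], so that this order becomes the identity
   with trivial signs and the second one carries the relative signs. *)
pose X i j k := rchi eps1 chi (f i) (f j) (f k).
have A' := rchi_alt eps1 A; have GP' := rchi_gp3 eps1 GP.
have AX : alternating X by split=> i j k; apply A'.
have GPX : gp3 X by move=> i j k l m; apply: GP'.
have [|||||[e12 l12]|l12] := @order_unique7 X (rk2 \o f)
  (fun i => eps2 (f i) (+) eps1 (f i)) AX GPX.
- move=> i j k l u al; rewrite /X !rchi_is0; apply: c4.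
    rewrite -(map_inj_in_uniq (f := f)) in u; first exact: u.
    by move=> ? ? /(allP al) hi /(allP al) hj; apply: fI.
  by move: al => /= /and5P[? ? ? ? _]; rewrite !fH.
- by move=> i j k i7 j7 k7 ij jk; apply: P1; rewrite ?fH ?ltf.
- by move=> i j i7 j7 /= h; apply: fI => //; apply: I2; rewrite ?fH.
- move=> i j k i7 j7 k7 /= ij jk.
  have := P2 _ _ _ (fH i i7) (fH j j7) (fH k k7) ij jk.
  rewrite /X /rchi.
  case: (eps1 (f i)); case: (eps1 (f j)); case: (eps1 (f k));
  case: (eps2 (f i)); case: (eps2 (f j)); case: (eps2 (f k));
  by case: (chi (f i) (f j) (f k)).
- move=> i /andP[i0 i7] /=; rewrite f0 ltn_neqAle M2 ?fH // andbT.
  apply/eqP => /(I2 _ _ aH (fH i i7)); rewrite -f0 => /fI E1.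
  by have E0 := E1 isT i7; rewrite -E0 in i0.
- have [i i7 xi] : exists2 i, i < 7 & x = f i by apply/fK/inW; rewrite !inE eqxx !orbT.
  have [j j7 yj] : exists2 i, i < 7 & y = f i by apply/fK/inW; rewrite !inE eqxx !orbT.
  split; first by rewrite xi yj => /(ltf' _ _ i7) ij; apply: l12.
  by have := e12 i i7; rewrite -xi; case: (eps1 x); case: (eps2 x).
have [i i7 bi] : exists2 i, i < 7 & b = f i by apply/fK/inW; rewrite !inE eqxx !orbT.
have [j j7 cj] : exists2 i, i < 7 & c = f i by apply/fK/inW; rewrite !inE eqxx !orbT.
have ij : i < j by apply: ltf'; rewrite -?bi -?cj.
have i0 : 0 < i.
  rewrite lt0n; apply: contraTneq uabc => i0; move: bi; rewrite i0 f0 => ->.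
  by rewrite /= inE eqxx.
by have := l12 i j i0 ij j7; rewrite /= -bi -cj ltnNge (ltnW L2).
Qed.

End Normal.

(** Only points other than the normalizing [a], [b], [c] are deleted. A comparison of [x] and [y]
    may be read in any such deletion that keeps both, since all of them agree. *)
Lemma posord_glue (E : finType) (G : {set E}) (chi : E -> E -> E -> sg) :
  alternating chi -> gp3 chi -> 9 <= #|G| ->
  (forall x y z t, uniq [:: x; y; z; t] -> all (fun p => p \in G) [:: x; y; z; t] ->
     is0 (chi x y z) -> is0 (chi x y t) -> False) ->
  (forall e, e \in G -> posord (fun x => x \in G :\ e) chi) ->
  posord (fun x => x \in G) chi.
Proof.
move=> A GP G9 c4 po.
have [a aG _] : exists2 a, a \in G & a \notin [::] by apply: exists_notin => /=; lia.
have [b bG ba] : exists2 b, b \in G & b \notin [:: a] by apply: exists_notin => /=; lia.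
have [c cG cba] : exists2 c, c \in G & c \notin [:: b; a] by apply: exists_notin => /=; lia.
have uabc : uniq [:: a; b; c].
  by move: ba cba; rewrite /= !inE !negb_or => ab /andP[bc ac]; rewrite ![a == _]eq_sym ab ac eq_sym bc.
pose V := G :\: [set x in [:: a; b; c]].
have VE v : v \in V -> [/\ v \in G, a != v, b != v & c != v].
  rewrite !inE !negb_or => /andP[/and3P[? ? ?] ?].
  by split=> //; rewrite eq_sym.
(* At least 9 - 3 = 6 points remain for deletion. *)
have avoid s : size s <= 5 -> exists2 v, v \in V & v \notin s.
  move=> h; apply: exists_notin; apply: leq_ltn_trans h _.
  rewrite /V cardsD; have : #|G :&: [set x in [:: a; b; c]]| <= 3; last lia.
  apply: leq_trans (subset_leq_card (subsetIr _ _)) _.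
  by rewrite cardsE; apply: card_size.
have /fin_all_exists[d dN] (v : E) : exists d : (E -> nat) * (E -> bool),
    v \in V -> normal chi a b c (G :\ v) d.1 d.2.
  case vV : (v \in V); last by exists (fun=> 0, fun=> false).
  have [vG av bv cv] := VE v vV.
  have [aH bH cH] : [/\ a \in G :\ v, b \in G :\ v & c \in G :\ v].
    by rewrite !inE av bv cv aG bG cG.
  by have [rk [eps N]] := exists_normal A aH bH cH uabc (po v vG); exists (rk, eps).
have agree v w x y : v \in V -> w \in V -> x \in G -> y \in G ->
    v \notin [:: x; y] -> w \notin [:: x; y] ->
    ((d v).1 x < (d v).1 y -> (d w).1 x < (d w).1 y) /\ (d v).2 x = (d w).2 x.
  move=> vV wV xG yG; rewrite !inE !negb_or => /andP[vx vy] /andP[wx wy].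
  have [vG av bv cv] := VE v vV; have [wG aw bw cw] := VE w wV.
  pose H := (G :\ v) :\ w.
  have sub z : z \in H -> z \in G by rewrite !inE => /and3P[].
  have H7 : 7 <= #|H|.
    have e1 := cardsD1 v G; have e2 : _ = _ + #|H| := cardsD1 w (G :\ v).
    move: G9; rewrite e1 e2 vG; move: #|H| (w \in _) => k t; clear; case: t => /=; lia.
  have restr u : H \subset G :\ u -> u \in V -> normal chi a b c H (d u).1 (d u).2.
    move=> /subsetP Hu /dN [I P M L]; split=> // [z t /Hu zu /Hu tu|z t p zH tH pH|z /Hu].
    - exact: I.
    - by apply: P; apply: Hu.
    - exact: M.
  apply: (normal_agree A GP (H := H) _ H7 _ _ _ uabc).
  - by move=> z t p q u al; apply: c4 u _; apply: sub_all al => r; apply: sub.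
  1-3: by rewrite !inE ?av ?bv ?cv ?aw ?bw ?cw.
  - by apply: restr => //; apply: subsetDl.
  - by apply: restr => //; apply/subsetP => z; rewrite !inE => /and3P[-> _ ->].
  - by rewrite !inE xG !(eq_sym x) vx wx.
  - by rewrite !inE yG !(eq_sym y) vy wy.
pose r x y := [exists v, [&& v \in V, v \notin [:: x; y] & (d v).1 x < (d v).1 y]].
have rP v x y : v \in V -> v \notin [:: x; y] -> x \in G -> y \in G ->
    r x y = ((d v).1 x < (d v).1 y).
  move=> vV vxy xG yG; apply/existsP/idP => [[w /and3P[wV wxy]]|h].
    by case: (agree w v x y wV vV xG yG wxy vxy).
  by exists v; rewrite vV vxy.
pose eps x := [exists v, [&& v \in V, v != x & (d v).2 x]].
have eP v x : v \in V -> v != x -> x \in G -> eps x = (d v).2 x.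
  move=> vV vx xG; have h u : u != x -> u \notin [:: x; x] by rewrite !inE => /negbTE->.
  apply/existsP/idP => [[w /and3P[wV wx]]|h'].
    by case: (agree w v x x wV vV xG xG (h _ wx) (h _ vx)) => _ ->.
  by exists v; rewrite vV vx.
(* Counting predecessors turns the glued relation into a rank; transitivity is read in a deletion
   that avoids three points. *)
pose rk x := #|[set y in G | r y x]|.
have dI v x y : v \in V -> x \in G -> y \in G -> v \notin [:: x; y] ->
    (d v).1 x = (d v).1 y -> x = y.
  move=> /dN[I _ _ _] xG yG; rewrite !inE negb_or => /andP[vx vy].
  by apply: I; rewrite !inE eq_sym ?vx ?vy ?(eq_sym y) ?vy.
have r_rk x y : x \in G -> y \in G -> r x y -> rk x < rk y.
  move=> xG yG rxy; apply: proper_card; apply/properP; split.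
    apply/subsetP => z; rewrite !inE => /andP[zG rzx]; rewrite zG.
    have [//|v vV] := avoid [:: x; y; z]; rewrite !inE !negb_or => /and3P[vx vy vz].
    have := rP v x y vV; have := rP v z x vV; have := rP v z y vV.
    rewrite !inE !negb_or vx vy vz => /(_ isT zG yG) -> /(_ isT zG xG) E1 /(_ isT xG yG) E2.
    by move: rzx rxy; rewrite E1 E2; apply: ltn_trans.
  exists x; rewrite inE xG ?rxy //.
  have [//|v vV] := avoid [:: x; x] => vx.
  by rewrite (rP v) // ltnn.
have rk_r x y : x \in G -> y \in G -> rk x < rk y -> r x y.
  move=> xG yG h; have [//|v vV vxy] := avoid [:: x; y].
  have vyx : v \notin [:: y; x] by move: vxy; rewrite !inE !negb_or andbC.
  rewrite (rP v) //; case: ltngtP => // [h'|/(dI v _ _ vV xG yG vxy) E1].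
    by have := r_rk y x yG xG; rewrite (rP v) // => /(_ h') /ltn_trans /(_ h); rewrite ltnn.
  by rewrite E1 ltnn in h.
exists rk, eps; split=> [x y xG yG E1|x y z xG yG zG /rk_r rxy /rk_r ryz].
  have [//|v vV vxy] := avoid [:: x; y].
  have vyx : v \notin [:: y; x] by move: vxy; rewrite !inE !negb_or andbC.
  case: (ltngtP ((d v).1 x) ((d v).1 y)) => h; last exact: (dI v).
    by have := r_rk x y xG yG; rewrite (rP v) // => /(_ h); rewrite E1 ltnn.
  by have := r_rk y x yG xG; rewrite (rP v) // => /(_ h); rewrite E1 ltnn.
have [//|v vV] := avoid [:: x; y; z]; rewrite !inE !negb_or => /and3P[vx vy vz].
have [_ P _ _] := dN v vV.
rewrite /rchi !(eP v) //; apply: P.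
1-3: by rewrite !inE ?xG ?yG ?zG andbT eq_sym.
  by rewrite -(rP v) ?rxy // !inE negb_or vx vy.
by rewrite -(rP v) ?ryz // !inE negb_or vy vz.
Qed.

(** * Lines with four points *)

Section Lines.
Variables (E : finType) (G : {set E}) (chi : E -> E -> E -> sg).
Hypotheses (A : alternating chi) (GP : gp3 chi).
Hypothesis span : forall x y, x \in G -> y \in G -> x != y ->
  exists2 z, z \in G & ~~ is0 (chi x y z).

(** In the relation with a point [w] off the line, only the term [chi x y w] times [chi x u v] is
    left. *)
Lemma collinear3 x y u v : x \in G -> y \in G -> x != y ->
  is0 (chi x y u) -> is0 (chi x y v) -> is0 (chi x u v).
Proof.
move=> xG yG /(span xG yG)[w wG]; have := GP x y w u v.
by case: (chi x y u); case: (chi x y v); case: (chi x y w); case: (chi x u v).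
Qed.

Lemma is0_swap12 x y z : is0 (chi y x z) = is0 (chi x y z).
Proof. by rewrite (chi_swap12 A); case: (chi x y z). Qed.

Lemma line_closed x y u v w : x \in G -> y \in G -> u \in G -> x != y ->
  is0 (chi x y u) -> is0 (chi x y v) -> is0 (chi x y w) -> is0 (chi u v w).
Proof.
move=> xG yG uG xy hu hv hw; have hvw := collinear3 xG yG xy hv hw.
case: (eqVneq u x) => [->//|ux].
by apply: (collinear3 uG xG ux); rewrite is0_swap12; apply: (collinear3 xG yG xy).
Qed.

Lemma line_ext x y u v w : x \in G -> y \in G -> u \in G -> v \in G -> x != y -> u != v ->
  is0 (chi x y u) -> is0 (chi x y v) -> is0 (chi u v w) -> is0 (chi x y w).
Proof.
move=> xG yG uG vG xy uv hu hv hw.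
have h t : is0 (chi x y t) -> is0 (chi u v t) by exact: line_closed.
by apply: (line_closed uG vG xG uv _ _ hw); apply: h; rewrite ?(chi_eq13 A) ?(chi_eq23 A).
Qed.

(** The Grassmann-Pluecker relation with [chi u v w] zero has only two terms left, which must
    agree. *)
Lemma line_ratio u v w y z : is0 (chi u v w) ->
  smul (chi u v y) (chi u w z) = smul (chi u v z) (chi u w y).
Proof.
have := GP u v w y z.
case: (chi u v w) => //; case: (chi u v y); case: (chi u w z);
by case: (chi u v z); case: (chi u w y).
Qed.

End Lines.

Section Insert.
Variables (E : finType) (G : {set E}) (chi : E -> E -> E -> sg).
Hypotheses (A : alternating chi) (GP : gp3 chi).
Hypothesis span : forall x y, x \in G -> y \in G -> x != y ->
  exists2 z, z \in G & ~~ is0 (chi x y z).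
Variables (x0 x1 b : E).
Hypotheses (x0G : x0 \in G) (x1G : x1 \in G) (x01 : x0 != x1) (bG : b \in G).
Definition online (u : E) := is0 (chi x0 x1 u).
Hypothesis bL : online b.

Lemma online3 u v w : u \in G -> online u -> online v -> online w -> chi u v w = Sg0.
Proof.
move=> uG hu hv hw; have := line_closed A GP span x0G x1G uG x01 hu hv hw.
by case: (chi u v w).
Qed.

Lemma offline u v w : u \in G -> v \in G -> u != v -> online u -> online v -> ~~ online w ->
  chi u v w <> Sg0.
Proof.
move=> uG vG uv hu hv /negP hw h; apply: hw.
by apply: (line_ext A GP span x0G x1G uG vG x01 uv hu hv); rewrite h.
Qed.

(* [L] stands for the points of the line other than [b]; they come first in the order
   [rk], and [b] is inserted before the points of rank at least [r]. *)
Lemma posord_insert rk r y : let L l := [&& l \in G, online l & l != b] in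
  (forall x y, x \in G :\ b -> y \in G :\ b -> rk x = rk y -> x = y) ->
  posfor (fun x => x \in G :\ b) rk chi ->
  (forall l z, L l -> z \in G -> ~~ online z -> rk l < rk z) ->
  (forall l z, L l -> z \in G -> ~~ online z -> chi l b z = chi l b y) ->
  (forall l, L l -> rk l < r -> chi l b y = SgP) ->
  (forall l, L l -> r <= rk l -> chi l b y = SgN) ->
  (forall z, z \in G -> ~~ online z -> r <= rk z) ->
  (forall z z', z \in G -> z' \in G -> ~~ online z -> ~~ online z' -> rk z < rk z' ->
     nneg (chi b z z')) ->
  posord (fun x => x \in G) chi.
Proof.
move=> L I P Lz ind I1 I2 I3 I4.
(* Old ranks become odd, so the even value for [b] falls just before the points of rank at least
   [r]. *)
pose rk' x := if x == b then r.*2 else (rk x).*2.+1.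
have bb : (rk' b < rk' b) = false by rewrite ltnn.
have bltx x : x != b -> (rk' b < rk' x) = (r <= rk x).
  by move=> xb; rewrite /rk' eqxx (negbTE xb) ltnS leq_double.
have xltb x : x != b -> (rk' x < rk' b) = (rk x < r).
  by move=> xb; rewrite /rk' eqxx (negbTE xb) ltn_Sdouble.
have xltx x x' : x != b -> x' != b -> (rk' x < rk' x') = (rk x < rk x').
  by move=> xb xb'; rewrite /rk' (negbTE xb) (negbTE xb') ltnS ltn_double.
have early u : u \in G -> rk u < r -> online u.
  by move=> uG ur; apply: contraLR ur => /(I3 u uG); rewrite leqNgt.
exists rk', (fun=> false); split.
  move=> u v uG vG; rewrite /rk'; case: eqP => [->|/eqP ub]; case: eqP => [->|/eqP vb] //.
  - by move=> /(congr1 odd); rewrite /= !odd_double.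
  - by move=> /(congr1 odd); rewrite /= !odd_double.
  - by case=> /double_inj h; apply: I; rewrite ?inE ?ub ?vb.
move=> u v w uG vG wG; rewrite /rchi /=.
case: (eqVneq u b) => [->|ub]; case: (eqVneq v b) => [->|vb]; rewrite ?bb //;
  case: (eqVneq w b) => [->|wb]; rewrite ?bb ?bltx ?xltb ?xltx // => uv vw.
- by rewrite ltnNge uv in vw.
- have rw : r <= rk w := leq_trans uv (ltnW vw).
  case: (boolP (online v)) => hv; case: (boolP (online w)) => hw.
  + by rewrite online3.
  + have Lv : L v by rewrite /L vG hv vb.
    by rewrite (chi_swap12 A) ind // I2.
  + have : rk w < rk v by apply: Lz => //; rewrite /L wG hw wb.
    by rewrite ltnNge (ltnW vw).
  + exact: I4.
- have hu := early u uG uv; case: (boolP (online w)) => hw; first by rewrite online3.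
  have Lu : L u by rewrite /L uG hu ub.
  by rewrite ind // I1.
- by rewrite online3 // early //; apply: ltn_trans vw.
- by apply: P; rewrite ?inE ?ub ?vb ?wb.
Qed.

Let L l := [&& l \in G, online l & l != b].

Lemma chi_off l l' z : L l -> L l' -> l != l' -> ~~ online z -> chi l l' z <> Sg0.
Proof. by case/and3P=> lG hl _ /and3P[l'G hl' _] ll'; apply: offline. Qed.

(* Seen from different points off the line, the points of the line have the same
   relative position, up to a global sign. *)
Lemma line_front rk y l1 l2 l3 :
  (forall x y, x \in G :\ b -> y \in G :\ b -> rk x = rk y -> x = y) ->
  posfor (fun x => x \in G :\ b) rk chi ->
  y \in G -> ~~ online y -> (forall x, x \in G :\ b -> rk y <= rk x) ->
  L l1 -> L l2 -> L l3 -> uniq [:: l1; l2; l3] ->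
  exists rk', [/\ forall x y, x \in G :\ b -> y \in G :\ b -> rk' x = rk' y -> x = y,
    posfor (fun x => x \in G :\ b) rk' chi &
    forall l z, L l -> z \in G -> ~~ online z -> rk' l < rk' z].
Proof.
move=> I P yG hy ymin L1 L2 L3 uL.
have LG l : L l -> l \in G :\ b by case/and3P=> lG _ lb; rewrite !inE lb.
have offG z : z \in G -> ~~ online z -> z \in G :\ b.
  by move=> zG hz; rewrite !inE zG andbT; apply: contra hz => /eqP ->.
have Loff l z : L l -> ~~ online z -> l != z.
  by case/and3P=> _ hl _; apply: contra => /eqP <-.
have lt_neq x x' : x \in G :\ b -> x' \in G :\ b -> x != x' -> (rk x' < rk x) = ~~ (rk x < rk x').
  move=> xG x'G; case: ltngtP => // /(I _ _ x'G xG) ->.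
  by rewrite eqxx.
have pos l l' : L l -> L l' -> rk l < rk l' -> chi l l' y = SgP.
  move=> Ll Ll' ll'; have ne : l != l' by apply: contraTneq ll' => ->; rewrite ltnn.
  have : nneg (chi y l l').
    have lH := LG l Ll; have l'H := LG l' Ll'; have yH := offG y yG hy.
    apply: P => //; rewrite lt_neq // ?Loff // -leqNgt; exact: ymin.
  rewrite -(chi_rot A); have := chi_off Ll Ll' ne hy.
  by case: (chi l l' y).
have posz l l' z : L l -> L l' -> z \in G -> ~~ online z -> rk l < rk l' ->
    (rk z < rk l) || (rk l' < rk z) -> chi l l' z = SgP.
  move=> Ll Ll' zG hz ll' zl; have ne : l != l' by apply: contraTneq ll' => ->; rewrite ltnn.
  have lH := LG l Ll; have l'H := LG l' Ll'; have zH := offG z zG hz.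
  have := chi_off Ll Ll' ne hz; have : nneg (chi l l' z); last by case: (chi l l' z).
  by case/orP: zl => h; [rewrite (chi_rot A)|]; apply: P.
have negz l l' z : L l -> L l' -> z \in G -> ~~ online z -> rk l < rk z -> rk z < rk l' ->
    chi l l' z = SgN.
  move=> Ll Ll' zG hz lz zl'; have ll' := ltn_trans lz zl'.
  have ne : l != l' by apply: contraTneq ll' => ->; rewrite ltnn.
  have lH := LG l Ll; have l'H := LG l' Ll'; have zH := offG z zG hz.
  have := chi_off Ll Ll' ne hz; have : nneg (chi l z l') by exact: P.
  by rewrite (chi_swap23 A); case: (chi l l' z).
have onl u v w : L u -> L v -> L w -> is0 (chi u v w).
  by case/and3P=> uG hu _ /and3P[_ hv _] /and3P[_ hw _]; rewrite online3.
(* A third point of the line lies on the same side of [z] as [l] or [l']. Seen from [y] all these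
   points are in order, while seen from [z] the pair on one side and the separated pair have
   different signs, against [line_ratio]. This is where three points besides [b] are needed. *)
have noz l l' z : L l -> L l' -> z \in G -> ~~ online z -> rk l < rk z -> rk z < rk l' -> False.
  move=> Ll Ll' zG hz lz zl'.
  have [m Lm [ml ml']] : exists2 m, L m & m != l /\ m != l'.
    have : has (fun m => (m != l) && (m != l')) [:: l1; l2; l3].
      move: uL; rewrite /= !inE negb_or andbT orbF => /andP[/andP[n12 n13] n23].
      apply: contraT; rewrite !negb_or !negb_and !negbK.
      move=> /and3P[/orP[]/eqP e1 /orP[]/eqP e2 /orP[]/eqP e3];
      by move: n12 n13 n23; rewrite e1 e2 e3 ?eqxx.
    by case/hasP=> m; rewrite !inE => /or3P[]/eqP-> /andP[]; [exists l1|exists l2|exists l3].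
  case: (ltnP (rk m) (rk z)) => mz.
    have [u [v [Lu Lv [uv vz]]]] : exists u v, [/\ L u, L v & rk u < rk v /\ rk v < rk z].
      case: (ltnP (rk m) (rk l)) => h; first by exists m, l.
      exists l, m; split=> //; split=> //.
      by rewrite lt_neq -?leqNgt ?LG.
    have uz := ltn_trans uv vz; have ul' := ltn_trans uz zl'.
    have := line_ratio GP y z (onl u v l' Lu Lv Ll').
    by rewrite (pos u v) // (negz u l') // (posz u v) ?vz ?orbT // (pos u l').
  have {}mz : rk z < rk m.
    rewrite lt_neq -?leqNgt //; [exact: LG|exact: offG|exact: Loff].
  have [u [v [Lu Lv [uv zu]]]] : exists u v, [/\ L u, L v & rk u < rk v /\ rk z < rk u].
    case: (ltnP (rk m) (rk l')) => h; first by exists m, l'.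
    exists l', m; split=> //; split=> //.
    by rewrite lt_neq -?leqNgt ?LG // eq_sym.
  have lv := ltn_trans lz (ltn_trans zu uv); have zv := ltn_trans zu uv.
  have := line_ratio GP y z (onl v u l Lv Lu Ll).
  rewrite (chi_swap12 A u v) (pos u v) // (chi_swap12 A l v) (negz l v) //.
  by rewrite (chi_swap12 A u v) (posz u v) ?zu // (chi_swap12 A l v) (pos l v).
(* Starting from the first point of the line sends everything before it to the end; by [noz] nothing
   off the line is left between points of the line. *)
have [l0 Ll0 l0min] := arg_minnP rk L1.
have bnd : exists N, forall x, x \in G :\ b -> rk x < N.
  exists (\max_x rk x).+1 => x _; rewrite ltnS; exact: (leq_bigmax (F := rk)).
have [N [I' P' _ hN]] := posfor_rotate A (LG _ Ll0) I P bnd.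
exists (fun x => if rk x < rk l0 then rk x + N else rk x); split=> // l z Ll zG hz /=.
rewrite [rk l < rk l0]ltnNge (l0min _ Ll) /=; case: ifP => [_|/negbT].
  by apply: ltn_addl; apply: hN; apply: LG.
rewrite -leqNgt => lz; have {}lz : rk l0 < rk z.
  by rewrite lt_neq -?leqNgt //; [exact: offG|exact: LG|rewrite eq_sym; exact: Loff].
rewrite lt_neq; [|exact: offG|exact: LG|by rewrite eq_sym Loff].
by apply/negP => zl; apply: (noz l0 l z).
Qed.

(* In the second case [b] comes after the points of [L] on the line, but the line through
   [z] and [z'] meets it between them and [b]. *)
Lemma line_dichotomy rk y b1 l2 :
  (forall x y, x \in G :\ b -> y \in G :\ b -> rk x = rk y -> x = y) ->
  posfor (fun x => x \in G :\ b) rk chi ->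
  (forall l z, L l -> z \in G -> ~~ online z -> rk l < rk z) ->
  y \in G -> ~~ online y -> L b1 -> (forall l, L l -> rk b1 <= rk l) ->
  L l2 -> l2 != b1 -> chi b1 b y = SgP ->
  posord (fun x => x \in G) chi \/
  (forall l z, L l -> z \in G -> ~~ online z -> chi l b z = SgP) /\
  exists z z', [/\ z \in G, z' \in G, ~~ online z, ~~ online z' &
    rk z < rk z' /\ chi b z z' = SgN].
Proof.
move=> I P F yG hy Lb1 b1min L2 l21 b1y.
have LG l : L l -> l \in G :\ b by case/and3P=> lG _ lb; rewrite !inE lb.
have offG z : z \in G -> ~~ online z -> z \in G :\ b.
  by move=> zG hz; rewrite !inE zG andbT; apply: contra hz => /eqP ->.
have lt_or l l' : L l -> L l' -> l != l' -> rk l < rk l' \/ rk l' < rk l.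
  move=> Ll Ll'; case: (ltngtP (rk l) (rk l')) => [|| /(I _ _ (LG _ Ll) (LG _ Ll')) ->]; first by left.
    by right.
  by rewrite eqxx.
have pos l l' z : L l -> L l' -> z \in G -> ~~ online z -> rk l < rk l' -> chi l l' z = SgP.
  move=> Ll Ll' zG hz ll'; have ne : l != l' by apply: contraTneq ll' => ->; rewrite ltnn.
  have lH := LG l Ll; have l'H := LG l' Ll'; have zH := offG z zG hz.
  have := chi_off Ll Ll' ne hz; have : nneg (chi l l' z) by apply: P => //; apply: F.
  by case: (chi l l' z).
have ind l z : L l -> z \in G -> ~~ online z -> chi l b z = chi l b y.
  move=> Ll zG hz.
  have [l' Ll' ne] : exists2 l', L l' & l != l'.
    by case: (eqVneq l b1) => [->|h]; [exists l2; rewrite // eq_sym | exists b1].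
  have h0 : is0 (chi l l' b).
    by move: (Ll) (Ll') => /and3P[lG hl _] /and3P[_ hl' _]; rewrite online3.
  have := line_ratio GP y z h0; case: (lt_or l l' Ll Ll' ne) => h.
    by rewrite !(pos l l').
  rewrite !(chi_swap12 A l' l) !(pos l' l) //=.
  by case: (chi l b z); case: (chi l b y).
have nz l : L l -> chi l b y <> Sg0.
  by move=> /and3P[lG hl lb]; apply: offline.
(* A positive [chi l b y] places [b] after [l] on the line, a negative one before it. With no
   negative value, [b] is tried just before the first point off the line. *)
case: (pickP (fun l => L l && ~~ nneg (chi l b y))) => [v0 Qv0|noN]; last first.
  have allP l z : L l -> z \in G -> ~~ online z -> chi l b z = SgP.
    by move=> Ll zG hz; rewrite ind //; have := noN l; have := nz l Ll; rewrite Ll; case: (chi l b y).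
  case: (pickP (fun p : E * E => [&& p.1 \in G, p.2 \in G, ~~ online p.1, ~~ online p.2 &
      (rk p.1 < rk p.2) && ~~ nneg (chi b p.1 p.2)])) => [[z z'] /=|nob].
    case/and5P=> zG z'G hz hz' /andP[zz' bad]; right; split=> //.
    by exists z, z'; split=> //; split=> //; case: (chi b z z') bad.
  left; have [z0 /andP[z0G hz0] z0min] := @arg_minnP _ y (fun z => (z \in G) && ~~ online z) rk (introT andP (conj yG hy)).
  apply: (@posord_insert rk (rk z0) y) => //.
  - by move=> l Ll _; rewrite allP.
  - by move=> l Ll; rewrite leqNgt F.
  - by move=> z zG hz; apply: z0min; rewrite zG.
  - move=> z z' zG z'G hz hz' zz'; have := nob (z, z').
    by rewrite /= zG z'G hz hz' zz' /=; case: (chi b z z').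
left; have [v /andP[Lv vN] vmin] :=
  @arg_minnP _ v0 (fun l => L l && ~~ nneg (chi l b y)) rk Qv0.
have {}vN : chi v b y = SgN by case: (chi v b y) vN.
have b1v : rk b1 < rk v.
  case: (lt_or b1 v Lb1 Lv) => [|//|]; last by rewrite ltnNge b1min.
  by apply/eqP => E1; rewrite E1 vN in b1y.
apply: (@posord_insert rk (rk v) y) => //.
- move=> l Ll lv; case E1: (chi l b y) => //; first by case: (nz l Ll).
  have : rk v <= rk l by apply: vmin; rewrite E1 andbT.
  by rewrite leqNgt lv.
(* Beyond [v] the sign stays negative, by the relation for [b1], [b], [v], [l] seen from [y]. *)
- move=> l Ll; rewrite leq_eqVlt => /orP[/eqP /(I _ _ (LG _ Lv) (LG _ Ll)) <- //|vl].
  have b1l := ltn_trans b1v vl; have := GP y b1 b v l.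
  rewrite -!(chi_rot A y) b1y (pos b1 v) // (pos b1 l) // (pos v l) //.
  by rewrite (chi_swap12 A v b) vN (chi_swap12 A l b); case: (chi l b y).
- by move=> z zG hz; apply: ltnW; apply: F.
(* As [b] lies between [b1] and [v], the relation expresses its value on [z], [z'] as a positive
   combination of those at [b1] and [v]. *)
- move=> z z' zG z'G hz hz' zz'.
  have := GP z z' b b1 v; rewrite -(chi_rot A z b1 v) (pos b1 v) //.
  rewrite -(chi_rot A z b v) (chi_swap12 A v b) ind // vN.
  rewrite -(chi_rot A z b b1) (chi_swap12 A b1 b) (ind b1) // b1y.
  rewrite -(chi_rot A b z z').
  have lz l : L l -> nneg (chi z z' l).
    move=> Ll; have lH := LG l Ll; have zH := offG z zG hz; have z'H := offG z' z'G hz'.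
    by rewrite (chi_rot A); apply: P => //; apply: F.
  have := lz b1 Lb1; have := lz v Lv.
  by case: (chi z z' b1); case: (chi z z' v); case: (chi z z' b).
Qed.

End Insert.

Section FourPoints.
Variables (E : finType) (G : {set E}).
Definition spanning (chi : E -> E -> E -> sg) := forall x y, x \in G -> y \in G -> x != y ->
  exists2 z, z \in G & ~~ is0 (chi x y z).

Lemma rchi_spanning eps chi : spanning chi -> spanning (rchi eps chi).
Proof. by move=> S x y xG yG /(S x y xG yG)[z zG h]; exists z; rewrite ?rchi_is0. Qed.

(** [line_dichotomy] after the normalizations by rotation and reorientation. The second case is kept
    as explicit data, to be confronted with a second deletion. *)
Lemma line_reinsert chi x0 x1 b y l1 l2 l3 : alternating chi -> gp3 chi -> spanning chi ->
  x0 \in G -> x1 \in G -> x0 != x1 -> b \in G -> online chi x0 x1 b ->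
  y \in G -> ~~ online chi x0 x1 y ->
  let L l := [&& l \in G, online chi x0 x1 l & l != b] in
  L l1 -> L l2 -> L l3 -> uniq [:: l1; l2; l3] ->
  posord (fun x => x \in G :\ b) chi ->
  posord (fun x => x \in G) chi \/
  exists rk eps, [/\ forall u v, u \in G :\ b -> v \in G :\ b -> rk u = rk v -> u = v,
    posfor (fun x => x \in G :\ b) rk (rchi eps chi),
    forall l z, L l -> z \in G -> ~~ online chi x0 x1 z -> rk l < rk z,
    forall l z, L l -> z \in G -> ~~ online chi x0 x1 z -> rchi eps chi l b z = SgP &
    exists z z', [/\ z \in G, z' \in G, ~~ online chi x0 x1 z, ~~ online chi x0 x1 z' &
      rk z < rk z' /\ rchi eps chi b z z' = SgN]].
Proof.
move=> A GP S x0G x1G x01 bG bL yG hy L L1 L2 L3 uL po.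
have LG l : L l -> l \in G :\ b by case/and3P=> lG _ lb; rewrite !inE lb.
have yb : y \in G :\ b by rewrite !inE yG andbT; apply: contra hy => /eqP ->.
have al : all (fun x => x \in G :\ b) (enum (G :\ b)) by apply/allP => x; rewrite mem_enum.
have ye : y \in enum (G :\ b) by rewrite mem_enum.
have [rk0 [eps0 [I0 P0 M0]]] := posord_min A po al ye.
have {}I0 u v : u \in G :\ b -> v \in G :\ b -> rk0 u = rk0 v -> u = v.
  by move=> uG vG; apply: I0; rewrite mem_enum.
have {}P0 : posfor (fun x => x \in G :\ b) rk0 (rchi eps0 chi).
  by move=> u v w uH vH wH; apply: P0 => /=; rewrite mem_enum.
have {}M0 u : u \in G :\ b -> rk0 y <= rk0 u by move=> uG; apply: M0; rewrite mem_enum.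
have onE eps u : online (rchi eps chi) x0 x1 u = online chi x0 x1 u by exact: rchi_is0.
have bLe eps : online (rchi eps chi) x0 x1 b by rewrite onE.
have hye eps : ~~ online (rchi eps chi) x0 x1 y by rewrite onE.
have Le eps l : L l -> [&& l \in G, online (rchi eps chi) x0 x1 l & l != b] by rewrite onE.
have [rk [I P F]] := line_front (rchi_alt eps0 A) (rchi_gp3 eps0 GP) (rchi_spanning _ S)
  x0G x1G x01 (bLe _) I0 P0 yG (hye _) M0 (Le _ _ L1) (Le _ _ L2) (Le _ _ L3) uL.
have [b1 Lb1 b1min] := @arg_minnP _ l1 L rk L1.
have [l2' L2' l21] : exists2 l, L l & l != b1.
  case: (eqVneq l1 b1) uL => [->|h] uL; [exists l2 => //|by exists l1].
  by move: uL; rewrite /= !inE negb_or eq_sym => /andP[/andP[]].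
(* The sign of [b] is free, since the order concerns the other points only; it is fixed by making
   the value at [b1], [b], [y] positive. *)
pose s := ~~ nneg (rchi eps0 chi b1 b y).
pose eps x := if x == b then eps0 x (+) s else eps0 x.
have epsE x : x \in G :\ b -> eps x = eps0 x by rewrite /eps !inE => /andP[/negbTE->].
have P' : posfor (fun x => x \in G :\ b) rk (rchi eps chi).
  by move=> u v w uG vG wG; rewrite /rchi !epsE //; apply: P.
have b1y : rchi eps chi b1 b y = SgP.
  have b1b : b1 != b by case/and3P: Lb1.
  have b1G : b1 \in G by case/and3P: Lb1.
  have nz : chi b1 b y <> Sg0.
    by move/and3P: Lb1 => [_ hb1 _]; apply: (offline A GP S x0G x1G x01).
  rewrite /rchi (epsE b1) ?(LG b1) // (epsE y) // /eps eqxx /s /rchi.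
  by case: (eps0 b1); case: (eps0 b); case: (eps0 y); case: (chi b1 b y) nz.
have F' l z : [&& l \in G, online (rchi eps chi) x0 x1 l & l != b] -> z \in G ->
    ~~ online (rchi eps chi) x0 x1 z -> rk l < rk z.
  by move=> Ll zG hz; apply: F => //; move: Ll hz; rewrite !onE.
have b1min' l : [&& l \in G, online (rchi eps chi) x0 x1 l & l != b] -> rk b1 <= rk l.
  by rewrite onE => Ll; apply: b1min.
case: (line_dichotomy (rchi_alt eps A) (rchi_gp3 eps GP) (rchi_spanning _ S)
  x0G x1G x01 bG (bLe _) I P' F' yG (hye _) (Le _ _ Lb1) b1min' (Le _ _ L2') l21 b1y).
  by move=> /posord_rchi; left.
case=> D [z [z' Z]].
right; exists rk, eps; split=> // [l z0 Ll z0G hz|l z0 Ll z0G hz|].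
- by apply: F' => //; rewrite onE.
- by apply: D => //; rewrite onE.
by exists z, z'; case: Z; rewrite !onE.
Qed.

(** Suppose that neither [a] nor the first remaining point [b1] can be reinserted. In the first
    order some [z], [z'] off the line give a negative sign at [a] and nonnegative ones at [p] and
    [q]. The second order forces the three signs to agree weakly, so those at [p] and [q] vanish.
    Then [p] and [q] lie on the line through [z] and [z'], which puts [z] on the line of [a] and
    [b]. *)
Lemma posord_four_points chi a b c d : alternating chi -> gp3 chi -> spanning chi ->
  a \in G -> b \in G -> c \in G -> d \in G -> uniq [:: a; b; c; d] ->
  is0 (chi a b c) -> is0 (chi a b d) ->
  (forall e, e \in G -> posord (fun x => x \in G :\ e) chi) ->
  posord (fun x => x \in G) chi.
Proof.
move=> A GP S aG bG cG dG u hc hd po.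
have ab : a != b by move: u; rewrite /= !inE !negb_or => /and3P[/and3P[]].
have [y yG hy] := S a b aG bG ab.
have oa : online chi a b a by rewrite /online (chi_eq13 A).
have ob : online chi a b b by rewrite /online (chi_eq23 A).
have [ba ca da] : [/\ b != a, c != a & d != a].
  by move: u; rewrite /= !inE !negb_or ![a == _]eq_sym => /and3P[/and3P[-> -> ->]].
have ubcd : uniq [:: b; c; d] by case/andP: u.
pose L l := [&& l \in G, online chi a b l & l != a].
have Lb : L b by apply/and3P.
have Lc : L c by apply/and3P.
have Ld : L d by apply/and3P.
case: (line_reinsert A GP S aG bG ab aG oa yG hy Lb Lc Ld ubcd (po a aG)) => //.
case=> rk [eps [I P F D [z [z' [zG z'G hz hz' [zz' bad]]]]]].
have [b1 [p [q [L1 Lp Lq u' [b1p b1q]]]]] : exists b1 p q,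
    [/\ L b1, L p, L q, uniq [:: b1; p; q] & rk b1 <= rk p /\ rk b1 <= rk q].
  move: ubcd; rewrite /= !inE !negb_or andbT => /andP[/andP[bc bd] cd].
  case: (leqP (rk b) (rk c)) => h1; case: (leqP (rk b) (rk d)) => h2.
  - by exists b, c, d; rewrite /= !inE negb_or bc bd cd.
  - exists d, b, c; rewrite /= !inE negb_or !(eq_sym d) bc bd cd; split=> //.
    by split; [exact: ltnW | exact: leq_trans (ltnW h2) h1].
  - exists c, b, d; rewrite /= !inE negb_or !(eq_sym c b) bc bd cd; split=> //.
    by split; [exact: ltnW | exact: leq_trans (ltnW h1) h2].
  case: (leqP (rk c) (rk d)) => h3.
    exists c, b, d; rewrite /= !inE negb_or !(eq_sym c b) bc bd cd; split=> //.
    by split; first exact: ltnW.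
  exists d, b, c; rewrite /= !inE negb_or !(eq_sym d) bc bd cd; split=> //.
  by split; exact: ltnW.
have LG l : L l -> l \in G :\ a by case/and3P=> lG _ la; rewrite !inE la.
have offG t : t \in G -> ~~ online chi a b t -> t \in G :\ a.
  by move=> tG ht; rewrite !inE tG andbT; apply: contra ht => /eqP ->.
have [n1p n1q npq] : [/\ b1 != p, b1 != q & p != q].
  by move: u'; rewrite /= !inE !negb_or andbT => /andP[/andP[-> ->] ->].
have lt1 l : L l -> b1 != l -> rk b1 <= rk l -> rk b1 < rk l.
  move=> Ll n1l h; rewrite ltn_neqAle h andbT; apply: contra n1l => /eqP /I -> //; exact: LG.
pose X := rchi eps chi.
have AX : alternating X := rchi_alt eps A.
have {}bad : X a z z' = SgN := bad.
have onE t : online X a b t = online chi a b t by exact: rchi_is0.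
have onL l : L l -> l \in G /\ online chi a b l by case/and3P.
have neg1 l : L l -> b1 != l -> rk b1 <= rk l -> X l b1 y = SgN.
  move=> Ll n1l h; have : X b1 l y <> Sg0.
    by apply: (offline AX (rchi_gp3 eps GP) (rchi_spanning _ S) aG bG ab); rewrite ?onE //;
       case: (onL _ L1); case: (onL _ Ll).
  have : nneg (X b1 l y).
    have lH := LG l Ll; have b1H := LG b1 L1; have yH := offG y yG hy.
    by apply: P => //; [exact: lt1 | exact: F].
  by rewrite (chi_swap12 AX b1 l); case: (X b1 l y).
have nega : X a b1 y = SgN by rewrite (chi_swap12 AX b1 a) (D b1 y L1 yG hy : X b1 a y = SgP).
have [b1G hb1 b1a] : [/\ b1 \in G, online X a b b1 & b1 != a].
  by rewrite onE; case/and3P: L1.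
have L' l : l \in G -> online chi a b l -> b1 != l -> [&& l \in G, online X a b l & l != b1].
  by move=> lG hl nl; rewrite lG onE hl eq_sym.
have L'p : [&& p \in G, online X a b p & p != b1] by case: (onL _ Lp) => *; apply: L'.
have L'q : [&& q \in G, online X a b q & q != b1] by case: (onL _ Lq) => *; apply: L'.
have L'a : [&& a \in G, online X a b a & a != b1] by apply: L'.
have upqa : uniq [:: p; q; a].
  rewrite /= !inE negb_or npq andbT.
  by case/and3P: Lp => _ _ ->; case/and3P: Lq => _ _ ->.
have poX : posord (fun x => x \in G :\ b1) X by apply/posord_rchi; apply: po.
have hyX : ~~ online X a b y by rewrite onE.
case: (line_reinsert AX (rchi_gp3 eps GP) (rchi_spanning _ S) aG bG ab b1G hb1 yG hyX
  L'p L'q L'a upqa poX) => [|[rk2 [eps2 [I2 P2 F2 D2 _]]]]; first by move/posord_rchi.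
exfalso.
have hzX : ~~ online X a b z by rewrite onE.
have hz'X : ~~ online X a b z' by rewrite onE.
have off1 t : t \in G -> ~~ online X a b t -> t \in G :\ b1.
  by move=> tG ht; rewrite !inE tG andbT; apply: contra ht => /eqP ->.
have on1 l : [&& l \in G, online X a b l & l != b1] -> l \in G :\ b1.
  by case/and3P=> lG _ lb; rewrite !inE lb.
(* [p], [q] and [a] all lie on the same side of [b1], so the second order reorients them alike. *)
have ep l : [&& l \in G, online X a b l & l != b1] -> X l b1 y = SgN ->
    eps2 l = ~~ (eps2 b1 (+) eps2 y).
  move=> Ll E1; have := D2 l y Ll yG hyX; rewrite /rchi E1.
  by case: (eps2 l); case: (eps2 b1); case: (eps2 y).
have zH := off1 z zG hzX; have z'H := off1 z' z'G hz'X.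
have zero l : [&& l \in G, online X a b l & l != b1] -> X l b1 y = SgN ->
    nneg (X l z z') -> X l z z' = Sg0.
  move=> Ll E1 N1; have el := ep l Ll E1; have ea := ep a L'a nega.
  have lH := on1 l Ll; have aH := on1 a L'a.
  case: (ltngtP (rk2 z) (rk2 z')) => [h|h|/(I2 _ _ zH z'H) Ez].
  - have := P2 l z z' lH zH z'H (F2 _ _ Ll zG hzX) h.
    have := P2 a z z' aH zH z'H (F2 _ _ L'a zG hzX) h.
    rewrite /rchi bad el ea; move: N1.
    by case: (eps2 b1 (+) eps2 y); case: (eps2 z); case: (eps2 z'); case: (X l z z').
  - have := P2 l z' z lH z'H zH (F2 _ _ Ll z'G hz'X) h.
    have := P2 a z' z aH z'H zH (F2 _ _ L'a z'G hz'X) h.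
    rewrite /rchi (chi_swap23 AX a z z') (chi_swap23 AX l z z') bad el ea; move: N1.
    by case: (eps2 b1 (+) eps2 y); case: (eps2 z); case: (eps2 z'); case: (X l z z').
  - by move: bad; rewrite Ez (chi_eq23 AX).
have zp l : L l -> b1 != l -> rk b1 <= rk l -> is0 (X z z' l).
  move=> Ll n1l h; case: (onL _ Ll) => lG hl.
  rewrite (chi_rot AX) zero ?L' // ?neg1 //.
  have lH := LG l Ll; have zH' := offG z zG hz; have z'H' := offG z' z'G hz'.
  by apply: P => //; apply: F.
have zz'n : z != z' by apply: contraTneq zz' => ->; rewrite ltnn.
have zpq := collinear3 (rchi_gp3 eps GP) (rchi_spanning _ S) zG z'G zz'n
  (zp p Lp n1p b1p) (zp q Lq n1q b1q).
case: (onL _ Lp) => pG hp; case: (onL _ Lq) => qG hq.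
have e : X p q z = Sg0.
  by have : is0 (X z p q) := zpq; rewrite (chi_rot AX z p q); case: (X z p q).
by case: (offline AX (rchi_gp3 eps GP) (rchi_spanning _ S) aG bG ab pG qG npq _ _ hzX e);
  rewrite onE.
Qed.

End FourPoints.

Lemma posord_of_deletions (E : finType) (G : {set E}) (chi : E -> E -> E -> sg) :
  alternating chi -> gp3 chi -> spanning G chi -> 7 <= #|G| ->
  (forall e, e \in G -> posord (fun x => x \in G :\ e) chi) ->
  posord (fun x => x \in G) chi.
Proof.
move=> A GP S G7 po.
pose bad (p : E * E * E * E) := let: (x, y, z, t) := p in
  [&& uniq [:: x; y; z; t], all (fun p => p \in G) [:: x; y; z; t],
      is0 (chi x y z) & is0 (chi x y t)].
case: (pickP bad) => [[[[x y] z] t] /and4P[u al h1 h2]|no].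
  by move: al => /= /and5P[xG yG zG tG _]; apply: (posord_four_points A GP S xG yG zG tG u).
have c4 x y z t : uniq [:: x; y; z; t] -> all (fun p => p \in G) [:: x; y; z; t] ->
    is0 (chi x y z) -> is0 (chi x y t) -> False.
  by move=> u al h1 h2; have := no (x, y, z, t); rewrite /bad u al h1 h2.
case: (leqP 9 #|G|) => [G9|G9]; first exact: posord_glue.
apply: posord_card_7_8 => //.
move: G7 G9; move: #|G| => n; clear; lia.
Qed.

(** * Chirotopes from circuits *)

Section Circuits.
Variables (E : finType) (G : {set E}) (C : {set sset E}).
Hypothesis OM : is_OM G C.

Definition csgn (X : sset E) e := if e \in X.1 then SgP else if e \in X.2 then SgN else Sg0.

Lemma csgn_supp (X : sset E) e : (e \in supp X) = ~~ is0 (csgn X e).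
Proof. by rewrite /supp inE /csgn; case: (e \in X.1); case: (e \in X.2). Qed.

Lemma csgn_opp (X : sset E) e : X \in C -> csgn (opp X) e = sopp (csgn X e).
Proof.
case: OM => D _ _ _ _ /D[_ /pred0P /(_ e)] /=; rewrite /csgn /=.
by case: (e \in X.1); case: (e \in X.2).
Qed.

Lemma circuit_opp X : X \in C -> opp X \in C. Proof. by case: OM => _ _ + _ _; apply. Qed.

Lemma supp_opp (X : sset E) : supp (opp X) = supp X. Proof. by rewrite /supp setUC. Qed.

Lemma circuit_elim X Y e : X \in C -> Y \in C -> X <> opp Y -> csgn X e = SgP ->
  csgn Y e = SgN -> exists2 Z, Z \in C & csgn Z e = Sg0 /\ forall f,
    csgn Z f = Sg0 \/ csgn Z f = csgn X f \/ csgn Z f = csgn Y f.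
Proof.
case: OM => D _ _ _ El XC YC XY Xe Ye; have [_ dX] := D X XC; have [_ dY] := D Y YC.
have eXY : e \in X.1 :&: Y.2.
  rewrite inE; move: Xe Ye; rewrite /csgn.
  by case: (e \in X.1); case: (e \in X.2); case: (e \in Y.1); case: (e \in Y.2).
have [Z ZC [/subsetP Z1 /subsetP Z2]] := El X Y e XC YC XY eXY.
exists Z => //; split.
  rewrite /csgn; case: ifP => [/Z1|_]; first by rewrite !inE eqxx.
  by case: ifP => // /Z2; rewrite !inE eqxx.
move=> f; have := disjointFr dX (x := f); have := disjointFr dY (x := f).
have := Z1 f; have := Z2 f; rewrite !inE /csgn.
case: (f \in Z.1).
  move=> _ /(_ isT) /andP[_ /orP[] ->]; first by right; left.
  by right; right.
case: (f \in Z.2); last by left.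
move=> /(_ isT) /andP[_ h] _ hY hX; case/orP: h => h; [right; left | right; right].
  by rewrite h; case E1: (f \in X.1) => //; have := hX E1; rewrite h.
by rewrite h; case E1: (f \in Y.1) => //; have := hY E1; rewrite h.
Qed.

(** Both circuits contain [x], as [I] is independent. If they were not equal or opposite,
    eliminating [x] would give a circuit inside [I]. *)
Lemma circuit_unique I x X Y : indep C I -> X \in C -> Y \in C ->
  supp X \subset x |: I -> supp Y \subset x |: I -> Y = X \/ Y = opp X.
Proof.
move=> indI.
have nz Z : Z \in C -> supp Z \subset x |: I -> csgn Z x <> Sg0.
  move=> ZC /subsetP ZI Zx; case/negP: (indI Z ZC); apply/subsetP => e eZ.
  by have := ZI e eZ; rewrite !inE => /orP[/eqP ex|//]; move: eZ; rewrite ex csgn_supp Zx.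
have key X' Y' : X' \in C -> Y' \in C -> supp X' \subset x |: I -> supp Y' \subset x |: I ->
    csgn X' x = SgP -> csgn Y' x = SgN -> X' = opp Y'.
  move=> X'C Y'C sX sY eX eY; apply/eqP; apply: contraT => /eqP ne.
  have [Z ZC [Zx Zf]] := circuit_elim X'C Y'C ne eX eY.
  case: (nz Z ZC) => //; apply/subsetP => f; rewrite csgn_supp => fZ.
  case: (Zf f) => [E1|[E1|E1]]; move: fZ; rewrite E1 // -csgn_supp.
    exact: (subsetP sX).
  exact: (subsetP sY).
have oppK (Z : sset E) : opp (opp Z) = Z by case: Z.
move=> XC YC sX sY; have nX := nz X XC sX; have nY := nz Y YC sY.
case EX: (csgn X x) nX => // _; case EY: (csgn Y x) nY => // _.
- left; rewrite (key X (opp Y)) ?oppK ?supp_opp ?circuit_opp //.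
  by rewrite csgn_opp // EY.
- by right; rewrite (key X Y) // oppK.
- by right; apply: key.
- left; rewrite -(oppK Y) -(key (opp X) Y) ?oppK ?supp_opp ?circuit_opp //.
  by rewrite csgn_opp // EX.
Qed.

Lemma csgn_unique I x X Y : indep C I -> X \in C -> Y \in C ->
  supp X \subset x |: I -> supp Y \subset x |: I ->
  (forall e, csgn Y e = csgn X e) \/ (forall e, csgn Y e = sopp (csgn X e)).
Proof.
move=> indI XC YC sX sY; case: (circuit_unique indI XC YC sX sY) => ->; first by left.
by right=> e; rewrite csgn_opp.
Qed.

Hypothesis simple : simple_om C.

(** All three conditions of simplicity in one; taking [x = y] excludes loops. *)
Lemma circuit_not_pair X x y : X \in C -> ~~ (supp X \subset [set x; y]).
Proof.
move=> XC; apply/negP => sX; have [s1 s2 s3] := simple x y; have [s1' s2' _] := simple y x.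
have [D n0 _ _ _] := OM.
have [_ dX] := D X XC.
have E0 : X = ([set z in [set x; y] | z \in X.1], [set z in [set x; y] | z \in X.2]).
  have h z : z \in supp X -> z \in [set x; y] by exact: (subsetP sX).
  rewrite [LHS]surjective_pairing; congr pair; apply/setP => z; rewrite [RHS]inE.
    case E1: (z \in X.1); last by rewrite andbF.
    by rewrite h // /supp inE E1.
  case E1: (z \in X.2); last by rewrite andbF.
  by rewrite h // /supp inE E1 orbT.
have E1 (P : pred E) : [set z in [set x; y] | P z] =
    (if P x then [set x] else set0) :|: (if P y then [set y] else set0).
  apply/setP => z; have m u : (z \in if P u then [set u] else set0) = (z == u) && P z.
    by case Pu: (P u); rewrite inE; case: eqP => // ->; rewrite Pu.
  by rewrite [RHS]inE !m !inE andb_orl.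
have oXC := circuit_opp XC; move: oXC XC; rewrite E0 /opp /= !E1.
have := disjointFr dX (x := x); have := disjointFr dX (x := y).
case: (x \in X.1); case: (y \in X.1); case: (x \in X.2); case: (y \in X.2).
all: rewrite ?setU0 ?set0U => dy dx h1 h2.
all: first [by case/negP: n0 | by case/negP: s1 | by case/negP: s1' | by case/negP: s2
  | by case/negP: s2' | by case/negP: s3 | by have := dx isT | by have := dy isT].
Qed.
End Circuits.

Section Chirok.
Variables (E : finType) (G : {set E}) (C : {set sset E}).
Hypothesis OM : is_OM G C.

(* [X] is the fundamental circuit of [x] with respect to the basis [a, b, c]. *)
Definition fundc (chi : E -> E -> E -> sg) a b c x X :=
  [/\ X \in C, supp X \subset x |: [set a; b; c], csgn X x = chi a b c,
      csgn X a = sopp (chi x b c) & csgn X b = sopp (chi a x c) /\ csgn X c = sopp (chi a b x)].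

(* [chi] is a chirotope of the restriction to [H], extended by zero. *)
Definition chirotope3 (H : {set E}) (chi : E -> E -> E -> sg) :=
  [/\ alternating chi,
      forall a b c, chi a b c <> Sg0 <->
        [/\ a \in H, b \in H, c \in H, uniq [:: a; b; c] & indep C [set a; b; c]] &
      forall a b c x, chi a b c <> Sg0 -> x \in H -> x \notin [:: a; b; c] ->
        exists X, fundc chi a b c x X].

Lemma fundc_subset chi a b c x X (S : {set E}) : fundc chi a b c x X ->
  (forall y, y \in [:: x; a; b; c] -> ~~ is0 (csgn X y) -> y \in S) -> supp X \subset S.
Proof.
case=> _ /subsetP sX _ _ _ h; apply/subsetP => y yX; apply: h; last by rewrite -csgn_supp.
by move: (sX y yX); rewrite !inE !orbA.
Qed.

Lemma fundc_out chi a b c x X y : fundc chi a b c x X -> y \notin [:: x; a; b; c] ->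
  csgn X y = Sg0.
Proof.
case=> _ /subsetP sX _ _ _; rewrite !inE => ny; have := csgn_supp X y.
case: (y \in supp X) (sX y) => [/(_ isT)|_]; last by case: (csgn X y).
by rewrite !inE -!orbA (negbTE ny).
Qed.

Section One.
Variables (H : {set E}) (chi : E -> E -> E -> sg).
Hypothesis K : chirotope3 H chi.

Let A : alternating chi. Proof. by case: K. Qed.

Lemma chirotope3_supp a b c : chi a b c <> Sg0 ->
  [/\ a \in H, b \in H, c \in H, uniq [:: a; b; c] & indep C [set a; b; c]].
Proof. by case: K => _ h _ /h. Qed.

(** For distinct points, let [X] and [Y] be the fundamental circuits of [d] and [e] over [a, b, c],
    and [W] that of [c] over [a, d, e]. Eliminating [b] between [X] and [Y], up to sign, leaves a
    circuit on [a, c, d, e], which is [W] or its opposite; the claim is read off at [c], [d], [e].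
    If [b] is missing from [X] or [Y], that circuit already is [W] up to sign. *)
Lemma chirotope3_exchange a b c d e :
  smul (chi a b c) (chi a d e) = SgP ->
  smul (chi a b d) (chi a c e) = SgP \/ smul (chi a b e) (chi a d c) = SgP.
Proof.
move=> p1; have n1 : chi a b c <> Sg0 by case: (chi a b c) p1.
have n2 : chi a d e <> Sg0 by case: (chi a b c) (chi a d e) p1 => [] [].
have [aH bH cH u1 i1] := chirotope3_supp n1; have [_ dH eH u2 i2] := chirotope3_supp n2.
case: (eqVneq d b) p1 => [->|db] p1.
  by right; rewrite -p1; case: (chi a b c); case: (chi a b e).
case: (eqVneq d c) p1 => [->|dc] p1; first by left.
case: (eqVneq e b) p1 => [->|eb] p1.
  left; rewrite -p1 (chi_swap23 A a b c) (chi_swap23 A a b d).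
  by case: (chi a b c); case: (chi a b d).
case: (eqVneq e c) p1 => [->|ec] p1; first by right.
have [ab ac ad ae] : [/\ b != a, c != a, d != a & e != a].
  by move: u1 u2; rewrite /= !inE !negb_or ![a == _]eq_sym
    => /and3P[/andP[-> ->] _ _] /and3P[/andP[-> ->] _ _].
have bc : b != c by move: u1; rewrite /= !inE !negb_or => /and3P[_ ->].
have de : d != e by move: u2; rewrite /= !inE !negb_or => /and3P[_ ->].
have [_ _ F] := K.
have [X FX] : exists X, fundc chi a b c d X.
  by apply: F; rewrite // !inE !negb_or ad db dc.
have [Y FY] : exists Y, fundc chi a b c e Y.
  by apply: F; rewrite // !inE !negb_or ae eb ec.
have [W FW] : exists W, fundc chi a d e c W.
  by apply: F; rewrite // !inE !negb_or ac ![c == _]eq_sym dc ec.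
have [XC sX Xd Xa [Xb Xc]] := FX; have [YC sY Ye Ya [Yb Yc]] := FY.
have [WC sW Wc Wa [Wd We]] := FW.
have Xe : csgn X e = Sg0.
  by apply: (fundc_out FX); rewrite !inE !negb_or ae eb ec eq_sym de.
have Yd : csgn Y d = Sg0 by apply: (fundc_out FY); rewrite !inE !negb_or ad db dc de.
have uniq_W Z : Z \in C -> csgn Z b = Sg0 -> (forall y, y \notin [:: a; b; c; d; e] ->
    csgn Z y = Sg0) -> (forall f, csgn Z f = csgn W f) \/ (forall f, csgn Z f = sopp (csgn W f)).
  move=> ZC Zb Zy; apply: (csgn_unique OM i2 WC ZC sW).
  apply/subsetP => y; rewrite csgn_supp => Zn; have : y \in [:: a; b; c; d; e].
    by apply: contraT => /Zy E1; rewrite E1 in Zn.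
  have : y != b by apply: contraNneq Zn => ->; rewrite Zb.
  by rewrite !inE => /negbTE-> /or4P[|//||/orP[]] ->; rewrite ?orbT.
have Xout y : y \notin [:: a; b; c; d; e] -> csgn X y = Sg0.
  rewrite !inE !negb_or => /and5P[ya yb yc yd _].
  by apply: (fundc_out FX); rewrite !inE !negb_or ya yb yc yd.
have Yout y : y \notin [:: a; b; c; d; e] -> csgn Y y = Sg0.
  rewrite !inE !negb_or => /and5P[ya yb yc _ ye].
  by apply: (fundc_out FY); rewrite !inE !negb_or ya yb yc ye.
have aec := chi_swap23 A a c e.
case Xb0: (is0 (csgn X b)).
  left; have : csgn X b = Sg0 by case: (csgn X b) Xb0.
  case/(uniq_W X XC)/(_ Xout) => e1; move: (e1 c) (e1 d); rewrite Xc Xd Wc Wd.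
    by move: p1; case: (chi a b c); case: (chi a d e); case: (chi a b d); case: (chi a c e).
  by move: p1; case: (chi a b c); case: (chi a d e); case: (chi a b d); case: (chi a c e).
case Yb0: (is0 (csgn Y b)).
  right; have : csgn Y b = Sg0 by case: (csgn Y b) Yb0.
  case/(uniq_W Y YC)/(_ Yout) => e1; move: (e1 c) (e1 e); rewrite Yc Ye Wc We;
  by move: p1; case: (chi a b c); case: (chi a d e); case: (chi a b e); case: (chi a d c).
have elim P Q : P \in C -> Q \in C -> csgn P b = SgP -> csgn Q b = SgN ->
    csgn P d <> Sg0 -> csgn Q d = Sg0 -> 
    (forall y, y \notin [:: a; b; c; d; e] -> csgn P y = Sg0) ->
    (forall y, y \notin [:: a; b; c; d; e] -> csgn Q y = Sg0) ->
    exists Z, ((forall f, csgn Z f = csgn W f) \/ (forall f, csgn Z f = sopp (csgn W f))) /\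
      forall f, csgn Z f = Sg0 \/ csgn Z f = csgn P f \/ csgn Z f = csgn Q f.
  move=> PC QC Pb Qb Pd Qd Pout Qout; have PQ : P <> opp Q.
    by move=> E1; apply: Pd; rewrite E1 (csgn_opp OM) // Qd.
  have [Z ZC [Zb Zf]] := circuit_elim OM PC QC PQ Pb Qb.
  exists Z; split=> //; apply: uniq_W => // y hy.
  by case: (Zf y) => [//|[]->]; [exact: Pout | exact: Qout].
have oX := circuit_opp OM XC; have oY := circuit_opp OM YC.
have oXE f := csgn_opp OM f XC; have oYE f := csgn_opp OM f YC.
have Xdn : csgn X d <> Sg0 by rewrite Xd.
have oXout y : y \notin [:: a; b; c; d; e] -> csgn (opp X) y = Sg0.
  by move=> hy; rewrite oXE Xout.
have oYout y : y \notin [:: a; b; c; d; e] -> csgn (opp Y) y = Sg0.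
  by move=> hy; rewrite oYE Yout.
(* [s] and [t] record whether [X] and [Y] are replaced by their opposites to get opposite signs at
   [b]. *)
have [Z [s [t [[Xs Yt] [HZ Zf]]]]] : exists Z s t,
    (sflip s (csgn X b) = SgP /\ sflip t (csgn Y b) = SgN) /\
    ((forall f, csgn Z f = csgn W f) \/ (forall f, csgn Z f = sopp (csgn W f))) /\
    forall f, csgn Z f = Sg0 \/ csgn Z f = sflip s (csgn X f) \/ csgn Z f = sflip t (csgn Y f).
  have Xdn' : csgn (opp X) d <> Sg0 by rewrite oXE; case: (csgn X d) Xdn.
  have Yd' : csgn (opp Y) d = Sg0 by rewrite oYE Yd.
  case Xbs: (csgn X b) Xb0 => // _; case Ybs: (csgn Y b) Yb0 => // _.
  - have oYb : csgn (opp Y) b = SgN by rewrite oYE Ybs.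
    have [Z [HZ Zf]] := elim X (opp Y) XC oY Xbs oYb Xdn Yd' Xout oYout.
    by exists Z, false, true; do 2!split=> //; move=> f; move: (Zf f); rewrite oYE.
  - have [Z [HZ Zf]] := elim X Y XC YC Xbs Ybs Xdn Yd Xout Yout.
    by exists Z, false, false.
  - have oXb : csgn (opp X) b = SgP by rewrite oXE Xbs.
    have oYb : csgn (opp Y) b = SgN by rewrite oYE Ybs.
    have [Z [HZ Zf]] := elim (opp X) (opp Y) oX oY oXb oYb Xdn' Yd' oXout oYout.
    by exists Z, true, true; do 2!split=> //; move=> f; move: (Zf f); rewrite oXE oYE.
  - have oXb : csgn (opp X) b = SgP by rewrite oXE Xbs.
    have [Z [HZ Zf]] := elim (opp X) Y oX YC oXb Ybs Xdn' Yd oXout Yout.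
    by exists Z, true, false; do 2!split=> //; move=> f; move: (Zf f); rewrite oXE.
move: (Zf c) (Zf d) (Zf e); rewrite Xc Xd Xe Yc Yd Ye.
move: Xs Yt; rewrite Xb Yb aec.
have [r Zr] : exists r, forall f, csgn Z f = sflip r (csgn W f).
  by case: HZ => HZ; [exists false | exists true].
rewrite !Zr Wc Wd We; clear -p1.
by case: s; case: t; case: r; case: (chi a b c) p1; case: (chi a d e) => //= _;
  case: (chi a d c) => //; case: (chi a c e) => //; case: (chi a b d); case: (chi a b e);
  move=> //= _ _; intuition congruence.
Qed.

Lemma chirotope3_gp3 : gp3 chi.
Proof. exact: gp3_of_exchange A chirotope3_exchange. Qed.

(** Otherwise [d], [e], [f] all lie on the line through [b] and [c]. As they form a basis, every
    triple with [d] and [b], or with [d] and [c], vanishes, and the fundamental circuit of [d] over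
    [a, b, c] shrinks to [d] alone. *)
Lemma chirotope3_basis_exchange a b c d e f : chi a b c <> Sg0 -> chi d e f <> Sg0 ->
  exists2 x, x \in [:: d; e; f] & chi x b c <> Sg0.
Proof.
move=> n1 n2; have [_ _ F] := K.
have [aH bH cH u1 i1] := chirotope3_supp n1; have [dH eH fH u2 i2] := chirotope3_supp n2.
case d0: (is0 (chi d b c)); last by exists d; rewrite ?mem_head //; case: (chi d b c) d0.
case e0: (is0 (chi e b c)).
  2: by exists e; rewrite ?inE ?eqxx ?orbT //; case: (chi e b c) e0.
case f0: (is0 (chi f b c)).
  2: by exists f; rewrite ?inE ?eqxx ?orbT //; case: (chi f b c) f0.
exfalso; have z s : is0 s -> s = Sg0 by case: s.
move: (z _ d0) (z _ e0) (z _ f0) => {}d0 {}e0 {}f0.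
have GP := chirotope3_gp3.
have bca : chi b c a <> Sg0 by rewrite (chi_rot A).
have cba : chi c b a <> Sg0 by rewrite (chi_swap13 A); case: (chi a b c) n1.
have bcz t : chi t b c = Sg0 -> chi b c t = Sg0 by rewrite (chi_rot A t b c).
have cbz t : chi t b c = Sg0 -> chi c b t = Sg0 by rewrite (chi_swap13 A t b c) => ->.
have colb t u : chi t b c = Sg0 -> chi u b c = Sg0 -> chi b t u = Sg0.
  move=> /bcz ht /bcz hu; have := GP b c a t u; rewrite ht hu.
  by case: (chi b c a) bca; case: (chi b t u).
have colc t u : chi t b c = Sg0 -> chi u b c = Sg0 -> chi c t u = Sg0.
  move=> /cbz ht /cbz hu; have := GP c b a t u; rewrite ht hu.
  by case: (chi c b a) cba; case: (chi c t u).
have db w : chi d b w = Sg0.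
  have := GP d e f b w; rewrite (chi_rot A b d e) colb // (chi_rot A b d f) colb //.
  by case: (chi d e f) n2; case: (chi d b w); case: (chi d f w); case: (chi d e w).
have dc w : chi d c w = Sg0.
  have := GP d e f c w; rewrite (chi_rot A c d e) colc // (chi_rot A c d f) colc //.
  by case: (chi d e f) n2; case: (chi d c w); case: (chi d f w); case: (chi d e w).
have dabc : d \notin [:: a; b; c].
  rewrite !inE !negb_or; apply/and3P; split; apply/eqP => Ed.
  - by apply: n1; rewrite -Ed.
  - by apply: bca; rewrite -Ed dc.
  - by apply: cba; rewrite -Ed db.
have [X FX] := F a b c d n1 dH dabc.
have [XC _ Xd Xa [Xb Xc]] := FX.
case/negP: (i2 X XC); apply: (fundc_subset FX) => y; rewrite !inE => /or4P[]/eqP->.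
- by rewrite eqxx.
- by rewrite Xa d0.
- by rewrite Xb -(chi_rot A) dc.
- by rewrite Xc (chi_swap13 A d b a) db.
Qed.

(** Each point lies in a basis, since otherwise its fundamental circuit would be a loop. If no [z]
    existed, the fundamental circuit of [y] over a basis containing [x] would lie in the pair [x],
    [y]. *)
Lemma chirotope3_spanning a b c : simple_om C -> chi a b c <> Sg0 -> spanning H chi.
Proof.
move=> simple n0 x y xH yH xy; have [_ _ F] := K.
have nn s : s <> Sg0 -> ~~ is0 s by case: s.
have [u [v n1]] : exists u v, chi x u v <> Sg0.
  case: (boolP (x \in [:: a; b; c])) => [|xo].
    rewrite !inE => /or3P[]/eqP->; first by exists b, c.
      by exists c, a; rewrite (chi_rot A).
    by exists a, b; rewrite -(chi_rot A).
  have [X FX] := F a b c x n0 xH xo; have [XC _ _ Xa [Xb Xc]] := FX.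
  case E1: (is0 (chi x b c)); last by exists b, c; case: (chi x b c) E1.
  case E2: (is0 (chi a x c)); last by exists c, a; rewrite (chi_rot A); case: (chi a x c) E2.
  case E3: (is0 (chi a b x)); last by exists a, b; rewrite -(chi_rot A); case: (chi a b x) E3.
  case/negP: (circuit_not_pair OM simple x x XC); apply: (fundc_subset FX) => z.
  rewrite !inE => /or4P[]/eqP->; rewrite ?eqxx // ?Xa ?Xb ?Xc.
  - by case: (chi x b c) E1.
  - by case: (chi a x c) E2.
  - by case: (chi a b x) E3.
have [_ uH vH u1 i1] := chirotope3_supp n1.
case E1: (is0 (chi x y v)); last by exists v => //; rewrite E1.
case E2: (is0 (chi x u y)); last first.
  by exists u => //; rewrite (chi_swap23 A); case: (chi x u y) E2.
exfalso; have yo : y \notin [:: x; u; v].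
  rewrite !inE !negb_or eq_sym xy /=; apply/andP; split; apply/eqP => Ey.
    by move: (nn _ n1); rewrite -Ey E1.
  by move: (nn _ n1); rewrite -Ey E2.
have [X FX] := F x u v y n1 yH yo; have [XC _ _ Xx [Xu Xv]] := FX.
case/negP: (circuit_not_pair OM simple x y XC); apply: (fundc_subset FX) => z.
rewrite !inE => /or4P[]/eqP->; rewrite ?eqxx ?orbT // ?Xu ?Xv.
- by case: (chi x y v) E1.
- by case: (chi x u y) E2.
Qed.

End One.

(** The quotient of two chirotopes is constant on common bases: exchanging one element preserves it,
    as both ratios are read off the same circuit up to sign. Three exchanges turn [a, b, c] into a
    permutation of [d, e, f]. *)
Lemma chirotope3_connected H1 H2 chi1 chi2 a b c d e f :
  chirotope3 H1 chi1 -> chirotope3 H2 chi2 ->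
  all (fun x => (x \in H1) && (x \in H2)) [:: a; b; c; d; e; f] ->
  chi1 a b c <> Sg0 -> chi1 d e f <> Sg0 ->
  smul (chi1 a b c) (chi2 a b c) = smul (chi1 d e f) (chi2 d e f).
Proof.
move=> K1 K2 al n1 n2; have [A1 _ F1] := K1; have [A2 nz2 F2] := K2.
have mem x : x \in [:: a; b; c; d; e; f] -> x \in H1 /\ x \in H2.
  by move=> /(allP al) /andP[].
pose g x y z := smul (chi1 x y z) (chi2 x y z).
have grot x y z : g y z x = g x y z by rewrite /g (chi_rot A1) (chi_rot A2).
have gsw x y z : g y x z = g x y z.
  by rewrite /g (chi_swap12 A1) (chi_swap12 A2); case: (chi1 x y z); case: (chi2 x y z).
have nz12 x y z : x \in H2 -> y \in H2 -> z \in H2 -> chi1 x y z <> Sg0 -> chi2 x y z <> Sg0.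
  by move=> xH yH zH /(chirotope3_supp K1)[_ _ _ u i]; apply/nz2; split.
have step x y z t : chi1 x y z <> Sg0 -> x \in H2 -> y \in H2 -> z \in H2 ->
    t \in H1 -> t \in H2 -> chi1 t y z <> Sg0 -> g x y z = g t y z.
  move=> n xH yH zH tH1 tH2 nt; case: (eqVneq t x) => [-> //|tx].
  have to : t \notin [:: x; y; z].
    rewrite !inE (negbTE tx) /= negb_or; apply/andP; split; apply/eqP => Et; apply: nt; rewrite Et.
      exact: (chi_eq12 A1).
    exact: (chi_eq13 A1).
  have [X FX] := F1 x y z t n tH1 to.
  have [Y FY] := F2 x y z t (nz12 _ _ _ xH yH zH n) tH2 to.
  have [XC sX Xt Xx _] := FX; have [YC sY Yt Yx _] := FY.
  have [_ _ _ _ ind] := chirotope3_supp K1 n.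
  have := csgn_unique OM ind XC YC sX sY; rewrite /g.
  case=> h; move: n nt (h t) (h x); rewrite Xt Xx Yt Yx;
  by case: (chi1 x y z); case: (chi1 t y z); case: (chi2 x y z); case: (chi2 t y z).
have [aH1 aH2] : a \in H1 /\ a \in H2 by apply: mem; rewrite !inE eqxx ?orbT.
have [bH1 bH2] : b \in H1 /\ b \in H2 by apply: mem; rewrite !inE eqxx ?orbT.
have [cH1 cH2] : c \in H1 /\ c \in H2 by apply: mem; rewrite !inE eqxx ?orbT.
have dd x : x \in [:: d; e; f] -> x \in H1 /\ x \in H2.
  by move=> h; apply: mem; rewrite !in_cons; move: h; rewrite !in_cons => ->; rewrite !orbT.
have [x xm nx] := chirotope3_basis_exchange K1 n1 n2; have [xH1 xH2] := dd x xm.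
have n3 : chi1 b c x <> Sg0 by rewrite (chi_rot A1).
have [y ym ny] := chirotope3_basis_exchange K1 n3 n2; have [yH1 yH2] := dd y ym.
have n4 : chi1 c x y <> Sg0 by rewrite (chi_rot A1).
have [z zm nz] := chirotope3_basis_exchange K1 n4 n2; have [zH1 zH2] := dd z zm.
rewrite -/(g a b c) -/(g d e f) (step _ _ _ x) // -grot (step _ _ _ y) // -grot.
rewrite (step _ _ _ z) //.
move: xm ym zm nz; rewrite !inE => /or3P[]/eqP-> /or3P[]/eqP-> /or3P[]/eqP->;
  rewrite ?(chi_eq12 A1) ?(chi_eq23 A1) ?(chi_eq13 A1) // => _.
all: first [done | by rewrite grot | by rewrite -grot | by rewrite gsw | by rewrite gsw grot
  | by rewrite gsw -grot].
Qed.

End Chirok.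

(** * Gluing the chirotopes of the deletions *)

Section Glue.
Variables (E : finType) (G : {set E}) (C : {set sset E}).
Hypotheses (OM : is_OM G C) (simple : simple_om C).

Definition is_basis3 (H : {set E}) a b c :=
  [/\ a \in H, b \in H, c \in H, uniq [:: a; b; c] & indep C [set a; b; c]].

Lemma chirotope3_opp H chi : chirotope3 C H chi -> chirotope3 C H (fun x y z => sopp (chi x y z)).
Proof.
case=> A nz F; have nzo s : sopp s <> Sg0 <-> s <> Sg0 by case: s.
split.
- by split=> x y z; [rewrite (chi_swap12 A x y) | rewrite (chi_swap23 A x y)].
- by move=> a b c; rewrite nzo.
- move=> a b c x /nzo n xH xn; have [X [XC sX Xx Xa [Xb Xc]]] := F a b c x n xH xn.
  exists (opp X); split; rewrite ?supp_opp ?(circuit_opp OM) // !(csgn_opp OM) //.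
  + by rewrite Xx.
  + by rewrite Xa.
  + by rewrite Xb Xc.
Qed.

Lemma fundc_scale chi1 chi2 s a b c x X : fundc C chi1 a b c x X -> s <> Sg0 ->
  chi2 a b c = smul s (chi1 a b c) -> chi2 x b c = smul s (chi1 x b c) ->
  chi2 a x c = smul s (chi1 a x c) -> chi2 a b x = smul s (chi1 a b x) ->
  exists X, fundc C chi2 a b c x X.
Proof.
case=> XC sX Xx Xa [Xb Xc]; case: s => // _ e0 e1 e2 e3.
  by exists X; split=> //; rewrite ?e0 ?e1 ?e2 ?e3.
exists (opp X); split; rewrite ?supp_opp ?(circuit_opp OM) // !(csgn_opp OM) //.
- by rewrite Xx e0.
- by rewrite Xa e1.
- by rewrite Xb Xc e2 e3.
Qed.

(* A triple is evaluated in the deletion of any point outside it and outside a fixed basis,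
   where all the chirotopes are normalized. *)
Lemma chirotope3_exists p q r : is_basis3 G p q r -> 7 <= #|G| ->
  (forall e a b c, e \in G -> is_basis3 (G :\ e) a b c -> exists chi, chirotope3 C (G :\ e) chi) ->
  exists chi, chirotope3 C G chi.
Proof.
case=> pG qG rG upqr ipqr G7 del.
pose V := G :\: [set x in [:: p; q; r]].
have VE v : v \in V -> [/\ v \in G, p \in G :\ v, q \in G :\ v & r \in G :\ v].
  rewrite !inE !negb_or => /andP[/and3P[vp vq vr] vG].
  by rewrite ![_ == v]eq_sym vp vq vr.
(* Four points always include one outside a given triple, but not one outside the four points of a
   fundamental circuit; this is why seven points need an extra argument. *)
have cV : 4 <= #|V|.
  rewrite /V cardsD; have : #|G :&: [set x in [:: p; q; r]]| <= 3.
    apply: leq_trans (subset_leq_card (subsetIr _ _)) _.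
    by rewrite cardsE; apply: card_size.
  by move: G7; clear; move: #|_| #|_| => m n; lia.
have /fin_all_exists[D HD] (v : E) : exists chi, v \in V ->
    chirotope3 C (G :\ v) chi /\ chi p q r = SgP.
  case vV : (v \in V); last by exists (fun _ _ _ => Sg0).
  have [vG pv qv rv] := VE v vV.
  have [|chi K] := del v p q r vG; first by split.
  have : chi p q r <> Sg0 by case: K => _ nz _; apply/nz; split.
  case E1: (chi p q r) => // _; first by exists chi.
  exists (fun x y z => sopp (chi x y z)) => _; rewrite E1; split=> //.
  exact: chirotope3_opp.
have KD v : v \in V -> chirotope3 C (G :\ v) (D v) by case/HD.
have AD v : v \in V -> alternating (D v) by case/KD.
have pqr v : v \in V -> D v p q r = SgP by case/HD.
have inGv v x y z : v \notin [:: x; y; z] -> x \in G -> y \in G -> z \in G ->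
    [/\ x \in G :\ v, y \in G :\ v & z \in G :\ v].
  rewrite !inE !negb_or => /and3P[vx vy vz] -> -> ->.
  by rewrite ![_ == v]eq_sym vx vy vz.
have nzD v x y z : v \in V -> v \notin [:: x; y; z] -> D v x y z <> Sg0 <-> is_basis3 G x y z.
  move=> vV vn; have [_ nz _] := KD v vV; split=> [/nz[]|[xG yG zG u i]].
    by rewrite !inE => /andP[_ ?] /andP[_ ?] /andP[_ ?] u i; split.
  by apply/nz; have [] := inGv v x y z.
have agree v w x y z : v \in V -> w \in V -> v \notin [:: x; y; z] -> w \notin [:: x; y; z] ->
    D v x y z = D w x y z.
  move=> vV wV vn wn; case E1: (is0 (D v x y z)).
    case E2: (is0 (D w x y z)); first by case: (D v x y z) E1; case: (D w x y z) E2.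
    have /(nzD w x y z wV wn)/(nzD v x y z vV vn) : D w x y z <> Sg0 by case: (D w x y z) E2.
    by case: (D v x y z) E1.
  have n1 : D v x y z <> Sg0 by case: (D v x y z) E1.
  have [xG yG zG u i] := (nzD v x y z vV vn).1 n1.
  have [xv yv zv] := inGv v x y z vn xG yG zG; have [xw yw zw] := inGv w x y z wn xG yG zG.
  have [_ pv qv rv] := VE v vV; have [_ pw qw rw] := VE w wV.
  have := chirotope3_connected (a := x) (b := y) (c := z) (d := p) (e := q) (f := r) OM (KD v vV) (KD w wV).
  rewrite /= xv yv zv xw yw zw pv qv rv pw qw rw (pqr v vV) (pqr w wV) /=.
  have nP : SgP <> Sg0 by [].
  by move=> /(_ isT n1 nP); case: (D v x y z); case: (D w x y z).
(* The default is never reached: some point of [V] avoids the triple. *)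
pose chi x y z := if [pick v in V | v \notin [:: x; y; z]] is Some v then D v x y z else Sg0.
have chiE v x y z : v \in V -> v \notin [:: x; y; z] -> chi x y z = D v x y z.
  move=> vV vn; rewrite /chi; case: pickP => [w /andP[wV wn]|/(_ v)]; first exact: agree.
  by rewrite vV vn.
have avoid s : size s <= 3 -> exists2 v, v \in V & v \notin s.
  by move=> h; apply: exists_notin; apply: leq_ltn_trans h _.
have Achi : alternating chi.
  split=> x y z; have [//|v vV vn] := avoid [:: x; y; z].
    rewrite !(chiE v) //; first by rewrite (chi_swap12 (AD v vV)).
    by move: vn; rewrite !inE !negb_or => /and3P[-> -> ->].
  rewrite !(chiE v) //; first by rewrite (chi_swap23 (AD v vV)).
  by move: vn; rewrite !inE !negb_or => /and3P[-> -> ->].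
have nzchi x y z : chi x y z <> Sg0 <-> is_basis3 G x y z.
  by have [//|v vV vn] := avoid [:: x; y; z]; rewrite (chiE v) //; apply: nzD.
exists chi; split=> // a b c x n xG xn.
case: (pickP (fun v => (v \in V) && (v \notin [:: a; b; c; x]))) => [v /andP[vV vn]|noV].
  have [_ _ F] := KD v vV.
  have sub y z t : y \in [:: a; b; c; x] -> z \in [:: a; b; c; x] -> t \in [:: a; b; c; x] ->
      chi y z t = D v y z t.
    move=> hy hz ht; apply: chiE => //; apply: contra vn.
    by rewrite !in_cons in_nil orbF => /or3P[]/eqP->.
  have inv y : y \in [:: a; b; c; x] -> y \in G -> y \in G :\ v.
    by move=> h yG; rewrite !inE yG andbT; apply: contraNneq vn => <-.
  have nF : D v a b c <> Sg0 by rewrite -sub // ?inE ?eqxx ?orbT.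
  have xGv : x \in G :\ v by apply: inv; rewrite ?inE ?eqxx ?orbT.
  have [X FX] := F a b c x nF xGv xn.
  by apply: (fundc_scale FX (s := SgP)); rewrite //= sub // ?inE ?eqxx ?orbT.
(* Now [G] has seven points: the basis [p, q, r] and [x, a, b, c]. The values on the last four
   points are compared with the chirotope of the deletion of a point of the basis. *)
have [aG bG cG uabc iabc] := (nzchi a b c).1 n.
have Vsub v : v \in V -> v \in [:: a; b; c; x].
  by move=> vV; have := noV v; rewrite vV /= => /negbT; rewrite negbK.
have uabcx : uniq [:: a; b; c; x].
  move: xn uabc; rewrite /= !inE !negb_or ![x == _]eq_sym.
  by case/and3P=> -> -> -> /and3P[/andP[-> ->] -> _].
have Vin y : y \in [:: a; b; c; x] -> y \in V.
  have /eqP E1 : V == [set y in [:: a; b; c; x]].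
    rewrite eqEcard; apply/andP; split; first by apply/subsetP => v /Vsub; rewrite inE.
    by rewrite cardsE (card_uniqP uabcx).
  by move=> h; rewrite E1 inE.
(* The deletion of [e] keeps [a, b, c, x] and has a fundamental circuit for them. The last condition
   supplies reference bases, which show that its chirotope equals [chi] up to one sign on the
   triples involved. *)
have key e u v : e \in [:: p; q; r] -> u \in [:: p; q; r] -> v \in [:: p; q; r] ->
    u != e -> v != e -> 
    (forall g, g \in [:: a; b; c] -> exists2 t, t \in [:: a; b; c] & t != g /\ chi u v t <> Sg0) ->
    exists X, fundc C chi a b c x X.
  move=> epqr upqr' vpqr ue ve good.
  have eV y : y \in [:: a; b; c; x] -> y != e.
    by move=> /Vin; rewrite inE inE => /andP[h _]; apply: contraNneq h => ->.
  have eG : e \in G by move: epqr; rewrite !inE => /or3P[]/eqP->.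
  have inGe y : y \in G -> y != e -> y \in G :\ e by rewrite !inE => -> ->.
  have [F KF] : exists F, chirotope3 C (G :\ e) F.
    by apply: (del e a b c eG); split; rewrite // inGe // eV // !inE eqxx ?orbT.
  have [AF nzF FF] := KF.
  have pqrG y : y \in [:: p; q; r] -> y \in G by rewrite !inE => /or3P[]/eqP->.
  have same f y z t : f \in V -> f \notin [:: y; z; t] -> y \in G :\ e -> z \in G :\ e ->
      t \in G :\ e -> chi y z t <> Sg0 -> forall t', t' \in [:: a; b; c; x] -> t' != f ->
      chi u v t' <> Sg0 ->
      smul (chi y z t) (F y z t) = smul (chi u v t') (F u v t').
    move=> fV fn ye ze te n1 t' ht' t'f n2.
    have fn' : f \notin [:: u; v; t'].
      rewrite !inE !negb_or eq_sym [f == t']eq_sym t'f andbT.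
      have fo w : w \in [:: p; q; r] -> w != f.
        by move=> hw; apply: contraTneq fV => <-; rewrite inE inE hw.
      by rewrite fo // eq_sym fo.
    rewrite (chiE f) // in n1 *; rewrite (chiE f) // in n2 *.
    have tG : t' \in G by move: (Vin _ ht'); rewrite inE => /andP[].
    have [uf vf t'f'] := inGv f u v t' fn' (pqrG _ upqr') (pqrG _ vpqr) tG.
    have [yG zG tG'] : [/\ y \in G, z \in G & t \in G].
      by move: ye ze te; rewrite !inE => /andP[_ ->] /andP[_ ->] /andP[_ ->].
    have [yf zf tf] := inGv f y z t fn yG zG tG'.
    apply: (chirotope3_connected OM (KD f fV) KF) => //=.
    have uGe : u \in G :\ e by apply: inGe => //; apply: pqrG.
    have vGe : v \in G :\ e by apply: inGe => //; apply: pqrG.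
    have t'Ge : t' \in G :\ e by apply: inGe => //; apply: eV.
    by rewrite yf zf tf ye ze te uf vf t'f' uGe vGe t'Ge.
  have xH : x \in G :\ e by rewrite inGe // eV // !inE eqxx ?orbT.
  have [aH bH cH] : [/\ a \in G :\ e, b \in G :\ e & c \in G :\ e].
    by split; apply: inGe => //; apply: eV; rewrite !inE eqxx ?orbT.
  have nFabc : F a b c <> Sg0 by apply/nzF; split.
  have [X FX] := FF a b c x nFabc xH xn.
  have z12 y z t : y \in G :\ e -> z \in G :\ e -> t \in G :\ e ->
      chi y z t <> Sg0 <-> F y z t <> Sg0.
    move=> yH zH tH; split=> [/nzchi[yG zG tG ? ?]|/nzF[_ _ _ ? ?]]; first by apply/nzF; split.
    by apply/nzchi; split=> //; [move: yH|move: zH|move: tH]; rewrite inE => /andP[].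
  (* The triple omitting [x] and the triple omitting [g] are compared through a basis
     [u, v, w], which avoids both [g] and [x]. *)
  have scale g y z t : g \in [:: a; b; c] -> g \notin [:: y; z; t] -> y \in G :\ e -> z \in G :\ e ->
      t \in G :\ e -> chi y z t = smul (smul (chi a b c) (F a b c)) (F y z t).
    move=> gabc gn yH zH tH; have [w wabc [wg nw]] := good g gabc.
    case E1: (is0 (F y z t)).
      have -> : F y z t = Sg0 by case: (F y z t) E1.
      case E2: (is0 (chi y z t)).
        by case: (chi y z t) E2 => // _; case: (smul (chi a b c) (F a b c)).
      have /(z12 y z t yH zH tH) : chi y z t <> Sg0 by case: (chi y z t) E2.
      by case: (F y z t) E1.
    have nF : F y z t <> Sg0 by case: (F y z t) E1.
    have nC : chi y z t <> Sg0 by apply/z12.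
    have wx : w != x by apply: contraNneq xn => <-.
    have w4 : w \in [:: a; b; c; x] by move: wabc; rewrite !inE => /or3P[]->; rewrite ?orbT.
    have gV : g \in V by apply: Vin; move: gabc; rewrite !inE => /or3P[]->; rewrite ?orbT.
    have xV : x \in V by apply: Vin; rewrite !inE eqxx ?orbT.
    have := same x a b c xV xn aH bH cH n w w4 wx nw.
    rewrite -(same g y z t gV gn yH zH tH nC w w4 wg nw).
    move: nF nC n nFabc.
    by case: (chi y z t); case: (F y z t); case: (chi a b c); case: (F a b c).
  have [na nb nc] : [/\ a \notin [:: x; b; c], b \notin [:: a; x; c] & c \notin [:: a; b; x]].
    move: uabcx; rewrite /= !inE !negb_or => /and4P[/and3P[ab ac ax] /andP[bc bx] cx _].
    by rewrite ax ab ac bx bc cx ![_ == a]eq_sym ![c == b]eq_sym ab bc ac.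
  apply: (fundc_scale FX (s := smul (chi a b c) (F a b c))).
  - by move: n nFabc; case: (chi a b c); case: (F a b c).
  - by move: n nFabc; case: (chi a b c); case: (F a b c).
  - by apply: (scale a) => //; rewrite !inE eqxx ?orbT.
  - by apply: (scale b) => //; rewrite !inE eqxx ?orbT.
  - by apply: (scale c) => //; rewrite !inE eqxx ?orbT.
have two u v : [|| ~~ is0 (chi u v a) && ~~ is0 (chi u v b), ~~ is0 (chi u v a) && ~~ is0 (chi u v c)
    | ~~ is0 (chi u v b) && ~~ is0 (chi u v c)] ->
    forall g, g \in [:: a; b; c] -> exists2 t, t \in [:: a; b; c] & t != g /\ chi u v t <> Sg0.
  have nn s : ~~ is0 s -> s <> Sg0 by case: s.
  have [ab ac bc] : [/\ a != b, a != c & b != c].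
    by move: uabc; rewrite /= !inE !negb_or => /and3P[/andP[-> ->] ->].
  move=> h g gabc; have {h} : [|| ~~ is0 (chi u v a) && (a != g), ~~ is0 (chi u v b) && (b != g)
      | ~~ is0 (chi u v c) && (c != g)].
    move: gabc; rewrite !inE => /or3P[]/eqP->; rewrite eqxx ?ab ?ac ?bc ?(eq_sym b a) ?(eq_sym c a)
      ?(eq_sym c b) ?ab ?ac ?bc ?andbT ?andbF /=;
    by move: h; case: (is0 (chi u v a)); case: (is0 (chi u v b)); case: (is0 (chi u v c)).
  by case/or3P=> /andP[/nn h1 h2]; [exists a|exists b|exists c]; rewrite // !inE eqxx ?orbT.
(* A point on both lines would be parallel to [q]. *)
have notboth t : t \in [:: a; b; c] -> is0 (chi p q t) -> is0 (chi q r t) -> False.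
  move=> tabc h1 h2; have tV : t \in V by apply: Vin; move: tabc; rewrite !inE => /or3P[]->; rewrite ?orbT.
  have xV : x \in V by apply: Vin; rewrite !inE eqxx ?orbT.
  have tx : t != x by apply: contraNneq xn => <-.
  have xpqr y : y \in [:: p; q; r] -> x != y.
    by move=> hy; apply: contraTneq xV => ->; rewrite inE inE hy.
  have tpqr : t \notin [:: p; q; r] by move: tV; rewrite inE inE => /andP[].
  have [_ px qx rx] := VE x xV.
  have [_ _ Fx] := KD x xV.
  have nx : D x p q r <> Sg0 by rewrite pqr.
  have tGx : t \in G :\ x by rewrite inE inE tx; move: tV; rewrite inE => /andP[].
  have [X FX] := Fx p q r t nx tGx tpqr; have [XC _ _ Xp [Xq Xr]] := FX.
  case/negP: (circuit_not_pair OM simple t q XC); apply: (fundc_subset FX) => y.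
  have xp3 y1 y2 : y1 \in [:: p; q; r] -> y2 \in [:: p; q; r] -> x \notin [:: y1; y2; t].
    by move=> hy1 hy2; rewrite !inE !negb_or (xpqr y1) // (xpqr y2) // eq_sym.
  rewrite !inE => /or4P[]/eqP->; rewrite ?eqxx ?orbT //.
  - rewrite Xp -(chi_rot (AD x xV)) -(chiE _ _ _ _ xV) ?xp3 ?inE ?eqxx ?orbT //.
    by case: (chi q r t) h2.
  - by rewrite Xr -(chiE _ _ _ _ xV) ?xp3 ?inE ?eqxx ?orbT //; case: (chi p q t) h1.
have [pq pr qr] : [/\ p != q, p != r & q != r].
  by move: upqr; rewrite /= !inE !negb_or => /and3P[/andP[-> ->] ->].
have [Na Nb Nc] : [/\ is0 (chi p q a) -> is0 (chi q r a) -> False,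
    is0 (chi p q b) -> is0 (chi q r b) -> False & is0 (chi p q c) -> is0 (chi q r c) -> False].
  by split; apply: notboth; rewrite !inE eqxx ?orbT.
(* None of [a], [b], [c] lies on both lines [p q] and [q r], so one of these lines misses at least
   two of them; the basis point off that line is deleted. *)
case T1: [|| ~~ is0 (chi p q a) && ~~ is0 (chi p q b), ~~ is0 (chi p q a) && ~~ is0 (chi p q c)
    | ~~ is0 (chi p q b) && ~~ is0 (chi p q c)].
  by apply: (key r p q); rewrite ?inE ?eqxx ?orbT //; apply: two.
have [qp rp] : q != p /\ r != p by rewrite ![_ == p]eq_sym pq pr.
apply: (key p q r); rewrite ?inE ?eqxx ?orbT //; apply: two.
move: T1 Na Nb Nc.
by case: (is0 (chi p q a)); case: (is0 (chi p q b)); case: (is0 (chi p q c));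
   case: (is0 (chi q r a)) => //; case: (is0 (chi q r b)) => //; case: (is0 (chi q r c)) => //=;
   move=> _ h1 h2 h3; first [case: (h1 isT isT) | case: (h2 isT isT) | case: (h3 isT isT)].
Qed.

End Glue.

(** * Reorientation and relabeling *)

Section Reorient.
Variables (E : finType) (A : {set E}).

Lemma reorientK : involutive (reorient A).
Proof.
case=> X1 X2; rewrite /reorient /=; congr pair; apply/setP => e; rewrite !inE;
by case: (e \in A); rewrite ?andbF ?andbT ?orbF.
Qed.

Lemma reorient_opp X : reorient A (opp X) = opp (reorient A X).
Proof. by []. Qed.

Lemma supp_reorient X : supp (reorient A X) = supp X.
Proof.
apply/setP => e; rewrite /supp !inE.
by case: (e \in A); rewrite ?andbF ?andbT ?orbF // orbC.
Qed.

Lemma csgn_reorient (X : sset E) e : [disjoint X.1 & X.2] ->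
  csgn (reorient A X) e = sflip (e \in A) (csgn X e).
Proof.
move=> /pred0P /(_ e) /=; rewrite /csgn /reorient /= !inE.
by case: (e \in A); case: (e \in X.1); case: (e \in X.2).
Qed.

Variables (G : {set E}) (C : {set sset E}).
Definition recirc := [set reorient A X | X in C].

Lemma mem_recirc X : (reorient A X \in recirc) = (X \in C).
Proof. by rewrite mem_imset //; apply: can_inj reorientK. Qed.

Lemma recirc_indep I : indep recirc I <-> indep C I.
Proof.
split=> H X XC; first by rewrite -supp_reorient; apply: H; rewrite mem_recirc.
by case/imsetP: XC => Y YC ->; rewrite supp_reorient; apply: H.
Qed.

Lemma recirc_OM : is_OM G C -> is_OM G recirc.
Proof.
case=> D n0 O I El; split.
- move=> _ /imsetP[X XC ->]; have [sX dX] := D X XC; rewrite supp_reorient; split=> //.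
  apply/pred0P => e /=; move/pred0P: dX => /(_ e) /=; rewrite !inE.
  by case: (e \in A); case: (e \in X.1); case: (e \in X.2).
- by rewrite -[(set0, set0)]reorientK mem_recirc /reorient /= !set0D !set0I setU0.
- by move=> _ /imsetP[X XC ->]; rewrite -reorient_opp mem_recirc O.
- move=> _ _ /imsetP[X XC ->] /imsetP[Y YC ->]; rewrite !supp_reorient => s.
  by case: (I X Y XC YC s) => ->; [left | right].
- move=> _ _ e /imsetP[X XC ->] /imsetP[Y YC ->] ne.
  have ne1 : X <> opp Y by move=> E1; apply: ne; rewrite E1.
  have ne2 : Y <> opp X by move=> E1; apply: ne; rewrite E1; case: (X).
  (* Reorienting at [e] swaps the roles of the two circuits in the elimination. *)
  case eA: (e \in A); rewrite !inE eA ?andbF ?andbT /= ?orbF => eXY.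
    have [|Z ZC [/subsetP Z1 /subsetP Z2]] := El Y X e YC XC ne2.
      by rewrite inE andbC.
    exists (reorient A Z); rewrite ?mem_recirc //; split; apply/subsetP => f; rewrite !inE;
    move: (Z1 f) (Z2 f); rewrite !inE; case: (f == e) => /=;
    case: (f \in A); case: (f \in Z.1) => //=; case: (f \in Z.2) => //=; rewrite ?andbT ?andbF ?orbF //=;
    move=> h1 h2 _; first [by have := h1 isT | by have := h2 isT | by rewrite orbC; exact: h1 | by rewrite orbC; exact: h2].
  have [|Z ZC [/subsetP Z1 /subsetP Z2]] := El X Y e XC YC ne1.
    by rewrite inE.
  exists (reorient A Z); rewrite ?mem_recirc //; split; apply/subsetP => f; rewrite !inE;
  move: (Z1 f) (Z2 f); rewrite !inE; case: (f == e) => /=;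
  case: (f \in A); case: (f \in Z.1) => //=; case: (f \in Z.2) => //=; rewrite ?andbT ?andbF ?orbF //=;
  move=> h1 h2 _; first [by have := h1 isT | by have := h2 isT | exact: h1 | exact: h2].
Qed.

Lemma recirc_rank n : om_rank G C n -> om_rank G recirc n.
Proof.
case=> -[I [IG iI cI]] mx; split; first by exists I; split=> //; apply/recirc_indep.
by move=> J JG /recirc_indep; apply: mx.
Qed.

Lemma chirotope3_reorient (H : {set E}) chi : is_OM G C -> chirotope3 C H chi ->
  chirotope3 recirc H (rchi (fun x => x \in A) chi).
Proof.
move=> OM [Al nz F]; have n0 x y z : rchi (fun x => x \in A) chi x y z <> Sg0 <-> chi x y z <> Sg0.
  rewrite /rchi; case: (x \in A); case: (y \in A); case: (z \in A); by case: (chi x y z).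
split; first exact: rchi_alt.
- move=> a b c; rewrite n0 nz; split=> -[? ? ? ? i]; split=> //; exact/recirc_indep.
- move=> a b c x /n0 n xH xn; have [X FX] := F a b c x n xH xn.
  have [XC sX Xx Xa [Xb Xc]] := FX.
  have [D _ _ _ _] := OM; have [_ dX] := D X XC.
  (* The reoriented circuit has the wanted signs up to the product of the signs of [x], [a], [b],
     [c], a constant that passing to the opposite circuit absorbs. *)
  have FR : fundc recirc (fun y z t => sflip ((x \in A) (+) (a \in A) (+) (b \in A) (+) (c \in A))
      (rchi (fun x => x \in A) chi y z t)) a b c x (reorient A X).
    rewrite /fundc mem_recirc supp_reorient !csgn_reorient // Xx Xa Xb Xc /rchi.
    split=> //; last split; case: (x \in A); case: (a \in A); case: (b \in A); case: (c \in A) => /=;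
    by [case: (chi a b c) | case: (chi x b c) | case: (chi a x c) | case: (chi a b x)].
  set s := (_ (+) _) in FR; apply: (fundc_scale (recirc_OM OM) FR (s := if s then SgN else SgP)).
  + by case: (s).
  all: by case: (s) => //=; case: (rchi _ _ _ _ _).
Qed.

End Reorient.

(** * Sign functions on triples and integer chirotopes on tuples *)

Import Order.TTheory GRing.Theory Num.Theory.
Local Open Scope ring_scope.

Definition int_of_sg s : int := match s with Sg0 => 0 | SgP => 1 | SgN => -1 end.
Definition sg_of_int (z : int) : sg := if z == 0 then Sg0 else if 0 < z then SgP else SgN.

Section Tuples.
Variable E : finType.
Implicit Types (a b c x : E) (t : 3.-tuple E).

Definition tri a b c : 3.-tuple E := [tuple a; b; c].

Lemma tri_eta t : exists a b c, t = tri a b c.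
Proof.
case/tupleP: t => a t; case/tupleP: t => b t; case/tupleP: t => c t.
by exists a, b, c; apply: val_inj; rewrite (tuple0 t).
Qed.

Lemma treplace_tri a b c x :
  [/\ treplace (tri a b c) 0 x = tri x b c, treplace (tri a b c) 1 x = tri a x c &
      treplace (tri a b c) 2 x = tri a b x].
Proof.
by split; apply: eq_from_tnth => -[[|[|[|i]]] hi] //; rewrite tnth_mktuple /= !(tnth_nth a).
Qed.

Let o0 := @Ordinal 3 0 isT.
Let o1 := @Ordinal 3 1 isT.
Let o2 := @Ordinal 3 2 isT.

Lemma ord3 (i : 'I_3) : [\/ i = o0, i = o1 | i = o2].
Proof. by case: i => -[|[|[|i]]] hi //; [constructor 1|constructor 2|constructor 3]; apply: val_inj. Qed.

Lemma tperm_tri a b c :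
  Defs.tperm (tri a b c) (perm.tperm o0 o1) = tri b a c /\
  Defs.tperm (tri a b c) (perm.tperm o1 o2) = tri a c b.
Proof.
by split; apply: eq_from_tnth => i; rewrite tnth_mktuple;
   case: (ord3 i) => ->; rewrite permE /= !(tnth_nth a).
Qed.

Variable chi : E -> E -> E -> sg.
Definition tchi t : int := int_of_sg (chi (tnth t o0) (tnth t o1) (tnth t o2)).

Lemma tchi_tri a b c : tchi (tri a b c) = int_of_sg (chi a b c).
Proof. by rewrite /tchi !(tnth_nth a). Qed.

Lemma tchi_tperm t (s : 'S_3) : alternating chi ->
  tchi (Defs.tperm t s) = (-1) ^+ (odd_perm s) * tchi t.
Proof.
move=> A; have sw i j t' : i != j ->
    tchi (Defs.tperm t' (perm.tperm i j)) = - tchi t'.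
  rewrite /tchi !tnth_mktuple.
  case: (ord3 i) => ->; case: (ord3 j) => -> //= _; rewrite !permE /=.
  - by rewrite (chi_swap12 A); case: (chi _ _ _).
  - by rewrite (chi_swap13 A); case: (chi _ _ _).
  - by rewrite (chi_swap12 A); case: (chi _ _ _).
  - by rewrite (chi_swap23 A); case: (chi _ _ _).
  - by rewrite (chi_swap13 A); case: (chi _ _ _).
  - by rewrite (chi_swap23 A); case: (chi _ _ _).
have [ts -> dts] := prod_tpermP s; elim: ts dts t => [|[i j] ts IH] /=.
  move=> _ t; rewrite big_nil odd_perm1 expr0 mul1r; congr tchi.
  by apply: eq_from_tnth => k; rewrite tnth_mktuple perm1.
case/andP=> ij /IH {}IH t; rewrite big_cons /= odd_permM odd_tperm signr_addb.
have -> : Defs.tperm t (perm.tperm i j * \prod_(u <- ts) perm.tperm u.1 u.2)%g =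
    Defs.tperm (Defs.tperm t (\prod_(u <- ts) perm.tperm u.1 u.2)%g) (perm.tperm i j).
  by apply: eq_from_tnth => k; rewrite !tnth_mktuple permM.
by rewrite sw // IH ij expr1 -mulrA mulN1r.
Qed.

Variables (G : {set E}) (C : {set sset E}).

Lemma uniq_card3 a b c : uniq [:: a; b; c] -> #|[set x in tri a b c]| = 3%N.
Proof. by move=> u; rewrite cardsE (card_uniqP u). Qed.

Lemma set_tri a b c : [set x in (tri a b c : seq E)] = [set a; b; c].
Proof. by apply/setP => x; rewrite !inE -orbA. Qed.

Lemma is_chirotope_tchi : is_OM G C -> om_rank G C 3 -> chirotope3 C G chi ->
  @is_chirotope E G C 3 tchi.
Proof.
move=> OM rk [A nz F]; split=> //.
- by move=> t _; rewrite /tchi; case: (chi _ _ _).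
- move=> t; have [a [b [c ->]]] := tri_eta t; rewrite tchi_tri /in_ground /= andbT => /and3P[aG bG cG].
  have -> : (int_of_sg (chi a b c) != 0) <-> chi a b c <> Sg0 by case: (chi a b c).
  rewrite nz set_tri; split=> [[_ _ _ u i]|[u [_ i _]]]; last by split.
  split=> //; split=> //; last by rewrite -set_tri uniq_card3.
  by apply/subsetP => x; rewrite !inE -orbA => /or3P[]/eqP->.
- by move=> t s _; apply: tchi_tperm.
- move=> t x; have [a [b [c ->]]] := tri_eta t; rewrite /in_ground /= andbT => /and3P[aG bG cG].
  move=> n xG xn; have n' : chi a b c <> Sg0 by move: n; rewrite tchi_tri; case: (chi a b c).
  have [X FX] := F a b c x n' xG xn; have [XC sX Xx Xa [Xb Xc]] := FX.
  have [_ _ _ u _] := (nz a b c).1 n'.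
  have [D _ _ _ _] := OM; have [sXG dX] := D X XC.
  have val e : fund_val tchi (tri a b c) x e = int_of_sg (csgn X e).
    rewrite /fund_val; have [T0 T1 T2] := treplace_tri a b c x.
    case: (eqVneq e x) => [->|ex]; first by rewrite Xx tchi_tri.
    case: (boolP (e \in (tri a b c : seq E))) => [|en]; last first.
      by rewrite (fundc_out FX) // in_cons negb_or ex.
    move: u; rewrite /= !inE !negb_or andbT => /andP[/andP[ab ac] bc].
    case: (eqVneq e a) => [-> _|ea].
      by rewrite /= ?eqxx T0 tchi_tri Xa; case: (chi x b c).
    case: (eqVneq e b) => [-> _|eb].
      by rewrite /= ?(negbTE ab) ?eqxx T1 tchi_tri Xb; case: (chi a x c).
    move=> /= /eqP->; rewrite /= ?(negbTE ac) ?(negbTE bc) ?eqxx T2 tchi_tri Xc.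
    by case: (chi a b x).
  suff -> : fund_circ G tchi (tri a b c) x = X by [].
  rewrite [RHS]surjective_pairing /fund_circ; congr pair; apply/setP => e; rewrite inE val.
    have := disjointFr dX (x := e); have := subsetP sXG e; rewrite /supp !inE /csgn.
    case: (e \in X.1) => /=; first by move=> /(_ isT) ->.
    by case: (e \in X.2); rewrite ?andbF.
  have := disjointFl dX (x := e); have := subsetP sXG e; rewrite /supp !inE /csgn.
  case: (e \in X.2) => /=; last by case: (e \in X.1); rewrite ?andbF.
  by rewrite orbT => /(_ isT) -> /(_ isT) ->.
Qed.

End Tuples.

Lemma iso_to_pos_of_posord (E : finType) (G : {set E}) (C : {set sset E}) chi :
  is_OM G C -> om_rank G C 3 -> chirotope3 C G chi -> posord (fun x => x \in G) chi ->
  iso_to_pos G C.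
Proof.
move=> OM rk3 K [rk [eps [I P]]]; pose A := [set x in G | eps x].
have OM' := recirc_OM A OM.
have K' := chirotope3_reorient A OM K.
exists E, G, (recirc A C); split=> //.
  exists 3%N, rk, (tchi (rchi (fun x => x \in A) chi)); split=> //.
    exact: is_chirotope_tchi OM' (recirc_rank A rk3) K'.
  move=> t; have [a [b [c ->]]] := tri_eta t; rewrite tchi_tri /in_ground /= !andbT.
  case/and3P=> aG bG cG /andP[ab bc]; have := P a b c aG bG cG ab bc.
  by rewrite /rchi !inE aG bG cG; case: (sflip _ _).
exists A, id; split=> //; first by apply/subsetP => x; rewrite inE => /andP[].
  by rewrite imset_id.
by apply: eq_imset => X; rewrite !imset_id -surjective_pairing.
Qed.

Lemma sg_of_intN z : sg_of_int (- z) = sopp (sg_of_int z).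
Proof. by rewrite /sg_of_int oppr_eq0 oppr_gt0; case: ltgtP => // ->. Qed.

Lemma sg_of_int_eq0 z : is0 (sg_of_int z) = (z == 0).
Proof. by rewrite /sg_of_int; case: (z == 0) => //; case: (0 < z). Qed.

Lemma recircK (E : finType) (A : {set E}) (C : {set sset E}) : recirc A (recirc A C) = C.
Proof. by apply/setP => X; rewrite -{1}[X](reorientK A) mem_recirc -{1}[X](reorientK A) mem_recirc reorientK. Qed.

(** The chirotope of the isomorphic matroid is pulled back along [f] and the reorientation by [A]
    undone. The basis [a, b, c] is assumed because a deletion might have smaller rank. *)
Lemma chirotope3_of_deletion (E : finType) (G : {set E}) (C : {set sset E}) e a b c :
  is_OM G C -> om_rank G C 3 -> is_basis3 C (G :\ e) a b c ->
  iso_to_pos (del_ground G e) (del_circ C e) ->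
  exists chi, chirotope3 C (G :\ e) chi /\ posord (fun x => x \in G :\ e) chi.
Proof.
move=> OM [_ rkmax] [aH bH cH uabc iabc].
case=> T [G' [C' [OM' [r [rk [chi' [rkI K P]]]] [A [f [AH fI fH C'E]]]]]].
rewrite /del_ground in fI fH AH; set H := G :\ e in aH bH cH AH fI fH *.
have [D _ _ _ _] := OM.
have DH X : X \in del_circ C e -> X \in C /\ supp X \subset H.
  rewrite inE => /andP[XC eX]; split=> //; have [sX _] := D X XC.
  by rewrite /H subsetD1 sX.
have supp_im (X : sset E) : supp (f @: X.1, f @: X.2) = f @: supp X by rewrite /supp imsetU.
have f_sub (S I : {set E}) : S \subset H -> I \subset H -> f @: S \subset f @: I -> S \subset I.
  move=> /subsetP sS /subsetP sI /subsetP h; apply/subsetP => x xS.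
  have /imsetP[y yI fxy] := h _ (imset_f f xS).
  by rewrite (fI x y (sS x xS) (sI y yI) fxy).
have indep_im (I : {set E}) : I \subset H -> (indep C' (f @: I) <-> indep C I).
  move=> IH; split=> h X XC.
    apply/negP => XI; have XD : X \in del_circ C e.
      by rewrite inE XC; apply: contraTN (subset_trans XI IH) => eX; apply/subsetPn; exists e; rewrite // !inE eqxx.
    have X'C : (f @: (reorient A X).1, f @: (reorient A X).2) \in C' by rewrite C'E; apply/imsetP; exists X.
    by have := h _ X'C; rewrite supp_im supp_reorient imsetS.
  move: XC; rewrite C'E => /imsetP[Y YD ->]; have [YC sY] := DH Y YD.
  rewrite supp_im supp_reorient; apply/negP => s.
  by case/negP: (h Y YC); apply: f_sub.
have tri_sub : [set a; b; c] \subset H.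
  by rewrite !subUset !sub1set aH bH cH.
(* Independent sets correspond under [f]: the rank bound of the matroid gives one inequality, the
   basis [a, b, c] the other. *)
have r3 : r = 3%N.
  have [[[J [JG iJ cJ]] mx] _ _ _ _] := K.
  apply/eqP; rewrite eqn_leq; apply/andP; split.
    pose I := [set x in H | f x \in J].
    have IH : I \subset H by apply/subsetP => x; rewrite inE => /andP[].
    have JE : f @: I = J.
      apply/setP => y; apply/imsetP/idP => [[x]|yJ]; first by rewrite inE => /andP[_ ?] ->.
      have := subsetP JG y yJ; rewrite -fH => /imsetP[x xH yx].
      by exists x; rewrite // inE xH -yx.
    rewrite -cJ -JE (leq_trans (leq_imset_card _ _)) //.
    apply: rkmax; first exact: subset_trans IH (subsetDl _ _).
    by apply/indep_im; rewrite ?JE.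
  have <- : #|f @: [set a; b; c]| = 3%N.
    rewrite card_in_imset; last by move=> x y /(subsetP tri_sub) xH /(subsetP tri_sub) yH; apply: fI.
    by rewrite -set_tri; apply: uniq_card3.
  apply: mx; first by rewrite -fH imsetS.
  exact/indep_im.
subst r; have [_ vals nz' alt' fund'] := K.
have fG x : x \in H -> f x \in G' by move=> xH; rewrite -fH imset_f.
have fI' x y : x \in H -> y \in H -> (f x == f y) = (x == y).
  by move=> xH yH; apply/eqP/eqP => [|->//]; apply: fI.
pose chi x y z := if [&& x \in H, y \in H & z \in H]
  then sg_of_int (chi' (tri (f x) (f y) (f z))) else Sg0.
have chiE x y z : x \in H -> y \in H -> z \in H ->
    chi x y z = sg_of_int (chi' (tri (f x) (f y) (f z))).
  by rewrite /chi => -> -> ->.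
have inG x y z : x \in H -> y \in H -> z \in H -> in_ground G' (tri (f x) (f y) (f z)).
  by move=> xH yH zH; rewrite /in_ground /= !fG.
have Achi : alternating chi.
  split=> x y z; rewrite /chi.
    rewrite [in LHS]andbCA; case: ifP => // /and3P[xH yH zH].
    have [<- _] := tperm_tri (f x) (f y) (f z).
    by rewrite alt' ?inG // odd_tperm /= expr1 mulN1r sg_of_intN.
  rewrite [(z \in H) && (y \in H)]andbC; case: ifP => // /and3P[xH yH zH].
  have [_ <-] := tperm_tri (f x) (f y) (f z).
  by rewrite alt' ?inG // odd_tperm /= expr1 mulN1r sg_of_intN.
have nzchi x y z : chi x y z <> Sg0 <->
    [/\ x \in H, y \in H, z \in H, uniq [:: x; y; z] & indep C [set x; y; z]].
  have uf : x \in H -> y \in H -> z \in H ->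
      uniq (tri (f x) (f y) (f z)) = uniq [:: x; y; z].
    by move=> xH yH zH; rewrite /= !inE !fI'.
  have sf : [set u in (tri (f x) (f y) (f z) : seq T)] = f @: [set x; y; z].
    by rewrite set_tri !imsetU !imset_set1.
  have sub : x \in H -> y \in H -> z \in H -> [set x; y; z] \subset H.
    by move=> xH yH zH; rewrite !subUset !sub1set xH yH zH.
  split=> [n|[xH yH zH u i]].
    have /and3P[xH yH zH] : [&& x \in H, y \in H & z \in H].
      by move: n; rewrite /chi; case: ifP.
    have : chi' (tri (f x) (f y) (f z)) != 0.
      by rewrite -sg_of_int_eq0 -chiE //; case: (chi x y z) n.
    move/nz' => /(_ (inG x y z xH yH zH)); rewrite uf // sf => -[u [_ i _]].
    by split=> //; apply/indep_im; rewrite ?sub.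
  have : chi' (tri (f x) (f y) (f z)) != 0.
    apply/nz'; rewrite ?inG // uf // sf; split=> //; split.
    - by rewrite -fH imsetS ?sub.
    - by apply/indep_im; rewrite ?sub.
    - by rewrite -sf uniq_card3 // uf.
  by rewrite -sg_of_int_eq0 -chiE //; case: (chi x y z).
(* Since [f] only relabels, the pulled-back function belongs to the circuits reoriented by [A]. *)
have K0 : chirotope3 (recirc A C) H chi.
  split=> //.
    move=> x y z; split=> [/nzchi[? ? ? ? i]|[? ? ? ? i]].
      by split=> //; apply/(recirc_indep A C).
    by apply/nzchi; split=> //; apply/(recirc_indep A C).
  move=> x y z t n tH tn; have [xH yH zH u _] := (nzchi x y z).1 n.
  have n' : chi' (tri (f x) (f y) (f z)) != 0.
    by rewrite -sg_of_int_eq0 -chiE //; case: (chi x y z) n.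
  have ftn : f t \notin (tri (f x) (f y) (f z) : seq T).
    by move: tn; rewrite /= !inE !fI'.
  have := fund' _ (f t) (inG x y z xH yH zH) n' (fG t tH) ftn.
  rewrite C'E => /imsetP[X0 X0D E0]; have [X0C sX0] := DH X0 X0D.
  pose X := reorient A X0; have sX : supp X \subset H by rewrite supp_reorient.
  have sX1 v : v \in X.1 -> v \in H by move=> h; apply: (subsetP sX); rewrite /supp inE h.
  have sX2 v : v \in X.2 -> v \in H by move=> h; apply: (subsetP sX); rewrite /supp inE h orbT.
  have im (S : {set E}) v : (forall v, v \in S -> v \in H) -> v \in H -> (f v \in f @: S) = (v \in S).
    move=> sS vH; apply/imsetP/idP => [[w wS]|vS]; last by exists v.
    by move=> /(fI v w vH (sS w wS)) ->.
  pose val v := fund_val chi' (tri (f x) (f y) (f z)) (f t) (f v).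
  have cX v : v \in H -> csgn X v = sg_of_int (val v).
    move=> vH; rewrite /csgn -(im X.1) // -(im X.2) //.
    have [E1 E2] : f @: X.1 = [set w in G' | 0 < fund_val chi' (tri (f x) (f y) (f z)) (f t) w] /\
        f @: X.2 = [set w in G' | fund_val chi' (tri (f x) (f y) (f z)) (f t) w < 0].
      by case: E0 => <- <-.
    by rewrite E1 E2 !inE fG //= -/(val v) /sg_of_int; case: ltgtP.
  have [T0 T1 T2] := treplace_tri (f x) (f y) (f z) (f t).
  move: (tn) (u); rewrite /= !inE !negb_or andbT => /and3P[tx ty tz] /andP[/andP[xy xz] yz].
  exists X; split.
  - by rewrite mem_recirc.
  - apply/subsetP => v vX; have vH := subsetP sX v vX; move: vX.
    rewrite csgn_supp cX // /val /fund_val !inE /= !fI' //.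
    by case: (v == t) => //=; rewrite -orbA; case: ifP.
  - by rewrite cX // /val /fund_val eqxx chiE.
  - rewrite cX // /val /fund_val /= !inE !fI' // eqxx eq_sym (negbTE tx) /=.
    by rewrite T0 sg_of_intN -chiE.
  - split; rewrite cX // /val /fund_val /= !inE !fI' // eqxx ?orbT.
      by rewrite eq_sym (negbTE ty) (negbTE xy) /= T1 sg_of_intN -chiE.
    by rewrite eq_sym (negbTE tz) (negbTE xz) (negbTE yz) /= T2 sg_of_intN -chiE.
exists (rchi (fun x => x \in A) chi); split.
  by have := chirotope3_reorient A (recirc_OM A OM) K0; rewrite recircK.
apply/posord_rchi; exists (rk \o f), (fun=> false); split.
  by move=> x y xH yH /= /(rkI _ _ (fG x xH) (fG y yH)); apply: fI.
move=> x y z xH yH zH /= xy yz; rewrite /rchi /= chiE //.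
have := P (tri (f x) (f y) (f z)) (inG x y z xH yH zH); rewrite /= xy yz => /(_ isT).
by rewrite /sg_of_int; case: ltgtP.
Qed.

Theorem theorem11p4 (E : finType) (G : {set E}) (C : {set sset E}) :
  is_OM G C -> simple_om C -> om_rank G C 3 -> (7 <= #|G|)%N ->
  almost_pos G C -> iso_to_pos G C.
Proof.
move=> OM simple rk3 G7 del.
have [[I [IG iI cI]] _] := rk3.
have [p [q [r tpqr]]] : exists p q r, is_basis3 C G p q r.
  have : size (enum I) = 3%N by rewrite -cardE.
  have uI := enum_uniq (mem I); have mI := mem_enum (mem I).
  case EI: (enum I) uI mI => [|p [|q [|r []]]] // u m _; exists p, q, r.
  have mE : I = [set p; q; r] by apply/setP => x; have := m x; rewrite !inE orbA => ->.
  by split; rewrite -?mE // (subsetP IG) // mE !inE eqxx ?orbT.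
have [chi K] : exists chi, chirotope3 C G chi.
  apply: (chirotope3_exists OM simple tpqr G7) => e a b c eG t.
  by have [chi [K _]] := chirotope3_of_deletion OM rk3 t (del e eG); exists chi.
have A : alternating chi by case: K.
have n0 : chi p q r <> Sg0 by case: K => _ nz _; apply/nz.
apply: (iso_to_pos_of_posord OM rk3 K).
apply: posord_of_deletions => //; first exact: (chirotope3_gp3 OM K).
  exact: (chirotope3_spanning OM K simple n0).
move=> e eG.
(* Either the deletion contains a basis, and its own chirotope is [chi] up to sign, or [chi]
   vanishes on it and every order is nonnegative. *)
case: (pickP (fun t : E * E * E => let: (a, b, c) := t in
    [&& a \in G :\ e, b \in G :\ e, c \in G :\ e & ~~ is0 (chi a b c)])) => [[[a b] c]|no].
  case/and4P=> aH bH cH n; have n1 : chi a b c <> Sg0 by case: (chi a b c) n.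
  have [_ _ _ u i] := chirotope3_supp K n1.
  have t : is_basis3 C (G :\ e) a b c by split.
  have [chi2 [K2 po]] := chirotope3_of_deletion OM rk3 t (del e eG).
  pose s := smul (chi a b c) (chi2 a b c).
  have sub x : x \in G :\ e -> x \in G by rewrite inE => /andP[].
  have eqs x y z : x \in G :\ e -> y \in G :\ e -> z \in G :\ e -> chi2 x y z = smul s (chi x y z).
    move=> xH yH zH; have [_ nz _] := K; have [_ nz2 _] := K2.
    have n12 : chi x y z <> Sg0 <-> chi2 x y z <> Sg0.
      by rewrite nz nz2; split=> -[? ? ? ? ?]; split=> //; apply: sub.
    case E1: (is0 (chi x y z)).
      have {}E1 : chi x y z = Sg0 by case: (chi x y z) E1.
      have : ~ chi2 x y z <> Sg0 by rewrite -n12 E1.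
      by rewrite E1; case: (chi2 x y z) => //; case: (s) => // h; case: h.
    have n2 : chi x y z <> Sg0 by case: (chi x y z) E1.
    have n3 : chi2 x y z <> Sg0 by apply/n12.
    have := chirotope3_connected (a := a) (b := b) (c := c) (d := x) (e := y) (f := z) OM K K2.
    rewrite /= aH bH cH xH yH zH !sub //= -/s => /(_ isT n1 n2) ->.
    by case: (chi x y z) n2; case: (chi2 x y z) n3.
  have s0 : s <> Sg0.
    have : chi2 a b c <> Sg0 by case: K2 => _ nz2 _; apply/nz2.
    by rewrite /s; case: (chi a b c) n1; case: (chi2 a b c).
  (* The rank being odd, reorienting every point negates the chirotope, which absorbs a negative
     [s]. *)
  apply: (eq_posord (chi := rchi (fun=> is0 (smul s SgP) || ~~ nneg s) chi2)); last exact/posord_rchi.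
  move=> x y z xH yH zH; rewrite /rchi eqs //; case: (s) s0 => //= _; by case: (chi x y z).
exists (enum_rank : E -> nat), (fun=> false); split=> [x y _ _ /ord_inj /enum_rank_inj //|].
move=> x y z xH yH zH _ _; rewrite /rchi /=.
by have := no (x, y, z); rewrite xH yH zH /=; case: (chi x y z).
Qed.
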